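(* Let $P$ and $Q$ be finite graded posets with isomorphic comparability graphs and let $c$ be a positive integer. Then there is a cardinality-preserving bijection between the set of rowmotion orbits of $J(P\times\mathbf{c})$ and the set of rowmotion orbits of $J(Q\times\mathbf{c})$. Consequently, $P$ has NRP rowmotion if and only if $Q$ has NRP rowmotion. In particular, if $P$ is a finite graded poset such that the ordinal sum $P\oplus\mathbf{1}$ has NRP rowmotion, then $\mathbf{1}\oplus P$ also has NRP rowmotion.
   Context: A finite poset is graded if all its maximal chains have the same length, where the length of a chain is its number of elements minus one; $\mathrm{rank}(P)$ is the length of a longest chain of $P$. $\mathbf{c}$ denotes a $c$-element chain, and $P\times\mathbf{c}$ is the product poset with componentwise order. $P\oplus Q$ is the ordinal sum: the disjoint union of $P$ and $Q$ with their orders, with every element of $P$ declared less than every element of $Q$. The comparability graph of $P$ is the graph on the elements of $P$ in which distinct $x,y$ are adjacent iff they are comparable. $J(Q)$ is the set of order ideals (down-sets) of $Q$. Rowmotion $\psi:J(Q)\to J(Q)$ sends an order ideal $I$ to the order ideal generated by the minimal elements of $Q\setminus I$; it is a bijection. A finite graded poset $P$ has NRP (''not relatively prime'') rowmotion if, for all positive integers $c$, no $\psi$-orbit of $J(P\times\mathbf{c})$ has cardinality relatively prime to $\mathrm{rank}(P)+c+1$. *)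

(* Defs.v *)
From HB Require Import structures.
From mathcomp Require Export all_boot all_order.
From mathcomp Require Export perm ssralg ssrint intdiv.

Set Implicit Arguments.
Unset Strict Implicit.
Unset Printing Implicit Defensive.

Import Order.TTheory GRing.Theory.
Local Open Scope order_scope.

Section Graded.
Context {d : Order.disp_t} {P : finPOrderType d}.

Definition is_chain (C : {set P}) : bool :=
  [forall x in C, forall y in C, x >=< y].

(* Lengths are integers because the empty chain has length -1; in particular
   the empty poset is graded of rank -1. *)
Definition chain_length (C : {set P}) : int := (#|C|%:Z - 1)%R.

Definition graded : Prop :=
  forall C D : {set P}, maxset is_chain C -> maxset is_chain D ->
    chain_length C = chain_length D.

Definition rank : int := ((\max_(C : {set P} | is_chain C) #|C|)%N%:Z - 1)%R.

Definition comparability_graph : rel P :=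
  [rel x y | (x != y) && (x >=< y)].

End Graded.
Arguments graded {d} P.
Arguments rank {d} P.
Arguments comparability_graph {d} P.

Definition graph_isomorphic (V W : finType) (e : rel V) (e' : rel W) : Prop :=
  exists2 f : V -> W, bijective f & forall x y, e' (f x) (f y) = e x y.

Section OrdinalSum.

Definition osum (T T' : Type) : Type := (T + T')%type.

Fact osum_display (d d' : Order.disp_t) : Order.disp_t.
Proof. exact: d. Qed.

HB.instance Definition _ (T T' : finType) := Finite.on (osum T T').

Context {d d' : Order.disp_t} (P : finPOrderType d) (Q : finPOrderType d').

Definition osum_le (u v : osum P Q) : bool :=
  match u, v with
  | inl x, inl y => x <= y
  | inl _, inr _ => true
  | inr _, inl _ => false
  | inr x, inr y => x <= y
  end.

Fact osum_le_refl : reflexive osum_le.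
Proof. by case=> x /=. Qed.

Fact osum_le_anti : antisymmetric osum_le.
Proof. by case=> x [] y //= /le_anti->. Qed.

Fact osum_le_trans : transitive osum_le.
Proof. by case=> y [] x [] z //=; apply: le_trans. Qed.

HB.instance Definition _ :=
  Order.Le_isPOrder.Build (osum_display d d') (osum P Q)
    osum_le_refl osum_le_anti osum_le_trans.

End OrdinalSum.

Section Rowmotion.
Context {d : Order.disp_t} (P : finPOrderType d).

Definition is_ideal (I : {set P}) : bool :=
  [forall x in I, forall y, (y <= x) ==> (y \in I)].

Record ideal := Ideal { ideal_set :> {set P}; ideal_setP : is_ideal ideal_set }.

HB.instance Definition _ := [isSub for ideal_set].
HB.instance Definition _ := [Finite of ideal by <:].

Definition down_closure (A : {set P}) : {set P} :=
  [set x | [exists y in A, x <= y]].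

Definition minimals (A : {set P}) : {set P} :=
  [set x in A | ~~ [exists y in A, y < x]].

Lemma down_closure_ideal (A : {set P}) : is_ideal (down_closure A).
Proof.
apply/forall_inP => x; rewrite inE => /exists_inP[z zA xz].
apply/forallP => y; apply/implyP => yx.
by rewrite inE; apply/exists_inP; exists z => //; apply: le_trans xz.
Qed.

Definition rowmotion (I : ideal) : ideal :=
  Ideal (down_closure_ideal (minimals (~: I))).

Lemma minimals_below (A : {set P}) (x : P) :
  x \in A -> exists2 y, y \in minimals A & y <= x.
Proof.
have [n] := ubnP #|[set z | z < x]|; elim: n x => // n IHn x le_n xA.
have [/exists_inP[y yA yx] | xmin] := boolP [exists y in A, y < x].
  have [|z zA zy] := IHn y _ yA; last by exists z => //; apply/ltW/le_lt_trans/yx.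
  rewrite -ltnS; apply: leq_trans le_n; rewrite ltnS; apply: proper_card; apply/properP; split.
    by apply/subsetP => z; rewrite !inE => /lt_trans; apply.
  by exists y; rewrite !inE ?ltxx.
by exists x; rewrite // inE xA.
Qed.

Lemma minimals_rowmotion (I J : ideal) (x : P) :
  rowmotion I = rowmotion J -> x \in minimals (~: I) -> x \in minimals (~: J).
Proof.
move=> eqIJ xI; have down K z : (z \in (rowmotion K : {set P})) =
    [exists y in minimals (~: K), z <= y] by rewrite inE.
have: x \in (rowmotion J : {set P}).
  by rewrite -eqIJ down; apply/exists_inP; exists x.
rewrite down => /exists_inP[y yJ xy].
have: y \in (rowmotion I : {set P}).
  by rewrite eqIJ down; apply/exists_inP; exists y.
rewrite down => /exists_inP[z zI yz].
suff -> : x = y by [].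
apply/le_anti; rewrite xy /=; apply: (le_trans yz).
have:= le_trans xy yz; rewrite le_eqVlt => /predU1P[->//|xz].
move: zI; rewrite inE => /andP[_ /exists_inP[]].
by exists x => //; move: xI; rewrite inE => /andP[].
Qed.

Lemma rowmotion_inj : injective rowmotion.
Proof.
have sub I J : rowmotion I = rowmotion J -> ~: I \subset ~: J.
  move=> eqIJ; apply/subsetP => x /minimals_below[y yI yx].
  have:= minimals_rowmotion eqIJ yI.
  rewrite !inE => /andP[yJ _]; apply: contra yJ => xJ.
  by move: (ideal_setP J) => /forall_inP/(_ x xJ)/forallP/(_ y)/implyP; apply.
move=> I J eqIJ; apply/val_inj/setC_inj/eqP; rewrite eqEsubset.
by rewrite (sub _ _ eqIJ) (sub _ _ (esym eqIJ)).
Qed.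

Definition rowmotion_orbits : {set {set ideal}} := porbits (perm rowmotion_inj).

End Rowmotion.

(* The chain with c elements is 'I_c, and *p is the componentwise product. *)
Definition nrp_rowmotion {d : Order.disp_t} (P : finPOrderType d) : Prop :=
  graded P /\
  forall c : nat, (0 < c)%N -> forall O, O \in rowmotion_orbits (P *p 'I_c) ->
    ~~ coprimez #|O| (rank P + c%:Z + 1)%R.

(* Main.v *)
(* Gradedness turns the ideals of P x c into the strictly increasing labelings
   of P by rank P + c + 1 labels.  Reading an orbit of rowmotion along diagonals,
   the layer of height j at time t + j, turns rowmotion into (inverse)
   K-promotion of these labelings.

   If M is a module (autonomous subset) of P, a labeling amounts to the labels
   outside M, the set of labels used on M, and a packed labeling of M.
   Promotion acts on the first two data regardless of the third, which it
   promotes or keeps.  Complementing labels conjugates promotion on M to inverse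
   promotion on the dual of M, and every permutation of a finite set is conjugate
   to its inverse, so reversing M does not change promotion up to conjugacy.

   Finally any two transitive orientations of a graph are linked by reversals of
   modules: colour a pair of vertices according to whether it is incomparable, or
   the orientations agree on it, or they disagree on it.  No triangle has three
   colours, hence some colour class is disconnected, and its components are
   modules. *)

Require Import Defs.
From mathcomp Require Import zify.

Set Implicit Arguments.
Unset Strict Implicit.
Unset Printing Implicit Defensive.

(** * Permutations and their inverses *)

(** The label bound is $q = N + c$ with $N$ the largest number of elements of a chain; it depends
    only on the comparability graph, so both posets are compared at the same $q$. The obstacle in
    exchanging a packed labeling of a module $M$ is that slides may pass through $M$. Elements
    outside see all of $M$ alike, so a slide entering from above can only pull up the largest label
    of $M$, and a slide leaving downwards can only leave from a minimal element of $M$. Some sliding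
    element of that kind exists in every packed labeling. Hence the outside alone decides whether
    $M$ is promoted at a given step, and a bijection that commutes with promotion on $M$ is
    compatible with both outcomes. For orientations, the basic situation is a cut across which the
    two orders agree; the other two kinds of cut are brought to it by reversing a suitable module of
    the second order. The bijection of orbits is not canonical: conjugating a permutation to its
    inverse requires a base point on each cycle. *)

Section InverseConjugation.
Variables (X : finType) (a : X -> X).
Hypothesis a_inj : injective a.

(** With [froot a x] as base point $\rho$ of the cycle, this is $a^n\rho \mapsto a^{-n}\rho$. *)
Definition orbit_reflection (x : X) : X :=
  iter (findex a (froot a x) x) (finv a) (froot a x).

Let iter_finv n x : iter n (finv a) (iter n a x) = x.
Proof. by elim: n x => // n IHn x; rewrite iterSr iterS (finv_f a_inj). Qed.

Let iter_finv' n x : iter n a (iter n (finv a) x) = x.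
Proof. by elim: n x => // n IHn x; rewrite iterSr iterS (f_finv a_inj). Qed.

Let iter_finv_eq m n x : iter m a x = iter n a x ->
  iter m (finv a) x = iter n (finv a) x.
Proof.
wlog le_mn : m n / m <= n.
  by move=> H E; case/orP: (leq_total m n) => h; [apply: H | apply/esym/H].
move=> E; have {E} Ex : x = iter (n - m) a x.
  by rewrite -[LHS](iter_finv m) E -{1}(subnKC le_mn) iterD iter_finv.
by rewrite -[in RHS](subnKC le_mn) iterD {2}Ex iter_finv.
Qed.

(** An exponent matters only modulo the cycle length, and equal forward iterates force equal
    backward ones; so any exponent reaching [x] may replace [findex]. *)
Lemma orbit_reflection_iter n x :
  iter n a (froot a x) = x -> orbit_reflection x = iter n (finv a) (froot a x).
Proof.
move=> E; apply: iter_finv_eq; rewrite E iter_findex //.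
by rewrite -(fconnect_sym a_inj) connect_root.
Qed.

Let root_iter x : iter (findex a (froot a x) x) a (froot a x) = x.
Proof. by rewrite iter_findex // -(fconnect_sym a_inj) connect_root. Qed.

Let root_eq x y : fconnect a x y -> froot a x = froot a y.
Proof. by move/(rootP (fconnect_sym a_inj)). Qed.

Lemma orbit_reflection_step x :
  orbit_reflection (a x) = finv a (orbit_reflection x).
Proof.
have E : froot a (a x) = froot a x by apply/esym/root_eq/fconnect1.
rewrite (@orbit_reflection_iter (findex a (froot a x) x).+1) E // iterS root_iter //.
Qed.

Lemma orbit_reflection_orbit x : fconnect a x (orbit_reflection x).
Proof.
apply: (connect_trans (connect_root _ x)); rewrite /orbit_reflection.
by elim: (findex _ _ _) => //= n IHn; apply: connect_trans IHn (fconnect_finv _ _).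
Qed.

Lemma orbit_reflectionK : involutive orbit_reflection.
Proof.
move=> x; have E := root_eq (orbit_reflection_orbit x).
have [n En] : exists n, iter n a (froot a x) = orbit_reflection x.
  exists (findex a (froot a x) (orbit_reflection x)).
  by rewrite iter_findex // E -(fconnect_sym a_inj) connect_root.
rewrite (@orbit_reflection_iter n) -E //.
have : iter n a (iter (findex a (froot a x) x) a (froot a x)) = froot a x.
  rewrite -iterD addnC iterD En /orbit_reflection iter_finv' //.
rewrite root_iter => {1}<-; exact: iter_finv.
Qed.

End InverseConjugation.

(** A list stands for the finite set because functions into [nat] form no finite type. The last
    conclusion, that [phi x] lies on the forward orbit of [x], lets every property preserved by [a]
    pass to [phi]. *)
Lemma conjugate_to_inverse (A : choiceType) (l : seq A) (a b : A -> A) :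
    {in l, forall x, a x \in l} -> {in l, cancel a b} ->
  exists phi : A -> A, {in l, forall x,
    [/\ phi x \in l, phi (phi x) = x, phi (a x) = b (phi x)
      & exists n, phi x = iter n a x]}.
Proof.
move=> al ab.
pose a' (x : seq_sub l) : seq_sub l := SeqSub (al _ (valP x)).
have a'inj : injective a'.
  by move=> x y /(congr1 val)/= E; apply/val_inj; rewrite -(ab _ (valP x)) E (ab _ (valP y)).
pose phi x := oapp (fun u : seq_sub l => val (orbit_reflection a' u)) x (insub x).
have phiE (u : seq_sub l) : phi (val u) = val (orbit_reflection a' u).
  by rewrite /phi valK.
have aE (u : seq_sub l) : a (val u) = val (a' u) by [].
have bE (u : seq_sub l) : b (val u) = val (finv a' u).
  by rewrite -[in LHS](f_finv a'inj u) -aE (ab _ (valP _)).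
exists phi => x xl; pose u : seq_sub l := SeqSub xl.
rewrite -[x]/(val u) aE !phiE; split.
- exact: valP.
- by rewrite orbit_reflectionK.
- by rewrite orbit_reflection_step // bE.
- have := iter_findex (orbit_reflection_orbit a' u).
  move: (findex _ _ _) => n <-; exists n.
  by elim: n => //= n <-.
Qed.

(** * Promotion of increasing labelings *)

Definition strict_order (T : Type) (r : rel T) : Prop :=
  irreflexive r /\ transitive r.

Definition dual (T : Type) (r : rel T) : rel T := fun x y => r y x.

Lemma dual_strict (T : Type) (r : rel T) : strict_order r -> strict_order (dual r).
Proof. by case=> irr tr; split=> [x|y x z]; rewrite /dual ?irr // => h1 /tr; apply. Qed.

Section Promotion.
Variable T : finType.
Implicit Types (r : rel T) (f g : {ffun T -> nat}) (x y z : T).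

Definition increasing r f := [forall x, forall y, r x y ==> (f x < f y)].

Definition labeling r (q : nat) f := [forall x, f x < q] && increasing r f.

Lemma increasingP r f :
  reflect (forall x y, r x y -> f x < f y) (increasing r f).
Proof.
apply: (iffP forallP) => h x; first by move=> y; have /forallP/(_ y)/implyP := h x.
by apply/forallP => y; apply/implyP; apply: h.
Qed.

Lemma labelingP r q f :
  reflect ((forall x, f x < q) /\ (forall x y, r x y -> f x < f y)) (labeling r q f).
Proof. by apply: (iffP andP) => -[/forallP h1 /increasingP]. Qed.

(** The value 0 of the empty maximum is the label a minimal element receives when it slides. *)
Definition floor_label r f x : nat := \max_(z | r z x) (f z).+1.

(** A vacated [y] is filled from the elements below it that carry the largest label found there; all
    of them, ties included, are vacated in turn. *)
Definition slide r f : rel T :=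
  [rel y z | r z y && ((f z).+1 == floor_label r f y)].

Definition sliding r q f x : bool :=
  [exists y, ((f y).+1 == q) && connect (slide r f) y x].

(* Inverse K-promotion: delete the largest label, refill by jeu de taquin
   slides, and increment. *)
Definition promotion r q f : {ffun T -> nat} :=
  [ffun x => if sliding r q f x then floor_label r f x else (f x).+1].

Lemma floor_label_ge r f x z : r z x -> f z < floor_label r f x.
Proof. by move=> rzx; apply: (@leq_bigmax_cond _ (r^~ x) (fun z => (f z).+1)). Qed.

Lemma floor_label_le r f x n :
  (forall z, r z x -> f z < n) -> floor_label r f x <= n.
Proof. by move=> h; apply/bigmax_leqP. Qed.

Lemma floor_label_attained r f x :
  floor_label r f x = 0 \/ exists2 z, r z x & (f z).+1 = floor_label r f x.
Proof.
have [/existsP[z rz]|/existsPn h] := boolP [exists z, r z x].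
  right; have [|w rw E] := @eq_bigmax_cond _ (fun z => r z x) (fun z => (f z).+1).
    by apply/card_gt0P; exists z.
  by exists w.
by left; apply: big_pred0 => z; apply/negbTE.
Qed.

Lemma slidingP r q f x :
  reflect ((f x).+1 = q \/
           exists y, [/\ r x y, sliding r q f y & floor_label r f y = (f x).+1])
          (sliding r q f x).
Proof.
apply: (iffP existsP) => [[y /andP[/eqP yq]]|[xq|[y [rxy]]]].
- case/connectP => s; elim/last_ind: s x => [|s w IH] x /=.
    by move=> _ ->; left.
  rewrite rcons_path last_rcons => /andP[ps sl] ->; right.
  exists (last y s); case/andP: sl => rw /eqP E; split=> //.
  by apply/existsP; exists y; rewrite yq eqxx; apply/connectP; exists s.
- by exists x; rewrite xq eqxx connect0.
- case/existsP=> w /andP[wq cy] E; exists w; rewrite wq.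
  by apply: connect_trans cy (connect1 _); rewrite /slide /= rxy E eqxx.
Qed.

Section Labeling.
Variables (r : rel T) (q : nat) (f : {ffun T -> nat}).
Hypothesis lab_f : labeling r q f.

Let f_lt x : f x < q. Proof. by case/labelingP: lab_f. Qed.
Let f_inc x y : r x y -> f x < f y. Proof. by case/labelingP: lab_f => _; apply. Qed.

Lemma floor_label_le_label x : floor_label r f x <= f x.
Proof. by apply: floor_label_le => z /f_inc. Qed.

Lemma promotion_ge x y : r x y -> f x < promotion r q f y.
Proof.
move=> rxy; rewrite ffunE; case: ifP => _; first exact: floor_label_ge.
by have := f_inc rxy; lia.
Qed.

Lemma promotion_labeling : labeling r q (promotion r q f).
Proof.
apply/labelingP; split=> [x|x y rxy]; rewrite !ffunE.
  case: ifP => [_|/slidingP nsx]; first exact: leq_ltn_trans (floor_label_le_label x) _.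
  by have := f_lt x; rewrite leq_eqVlt => /predU1P[|//] ?; case: nsx; left.
have lt_xy := f_inc rxy; have Lx := floor_label_le_label x.
have Ly := floor_label_ge f rxy.
case: ifP => sx; case: ifP => sy; try lia.
rewrite ltn_neqAle Ly andbT; apply/eqP => E.
by move/slidingP: sx; case; right; exists y.
Qed.

(** An element slides exactly when its incremented label would be [q] or is already taken by an
    element above it. This replaces slide paths by a recursion that looks only upwards. *)
Lemma promotion_rec x : promotion r q f x =
  if ((f x).+1 < q) && [forall y, r x y ==> (promotion r q f y != (f x).+1)]
  then (f x).+1 else floor_label r f x.
Proof.
rewrite [LHS]ffunE; case: ifP => [/slidingP[E|[y [rxy sy E]]]|/slidingP nsx].
- by rewrite E ltnn.
- case: ifP => // /andP[_ /forallP/(_ y)].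
  by rewrite rxy ffunE sy E eqxx.
- have -> : (f x).+1 < q.
    by have := f_lt x; rewrite leq_eqVlt => /predU1P[|//] ?; case: nsx; left.
  case: ifP => // /negP[]; apply/forallP => y; apply/implyP => rxy.
  apply/eqP; rewrite ffunE; case: ifP => [sy E|_ [E]]; first by case: nsx; right; exists y.
  by have := f_inc rxy; rewrite E ltnn.
Qed.

(** The recursion at [x] refers only to elements with a larger label, so induction on [q - f x]
    determines its solution. This is how promotion is recognised in the dual order, in rowmotion and
    after relabeling. *)
Lemma promotion_unique (f' : {ffun T -> nat}) :
  (forall x, f' x =
     if ((f x).+1 < q) && [forall y, r x y ==> (f' y != (f x).+1)]
     then (f x).+1 else floor_label r f x) ->
  f' = promotion r q f.
Proof.
move=> rec; apply/ffunP => x; have [n] := ubnP (q - f x).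
elim: n x => // n IHn x le_n; rewrite rec promotion_rec.
congr (if _ && _ then _ else _); apply: eq_forallb => y.
case: (boolP (r x y)) => //= /f_inc lt_xy; rewrite IHn //.
by have := f_lt y; lia.
Qed.

End Labeling.

Definition complement (q : nat) f : {ffun T -> nat} := [ffun x => q - (f x).+1].

Lemma complement_labeling r q f :
  labeling r q f -> labeling (dual r) q (complement q f).
Proof.
move=> /labelingP[lt_q inc]; apply/labelingP; split=> [x|x y /inc].
  by rewrite ffunE; have := lt_q x; lia.
by rewrite !ffunE; have := lt_q x; lia.
Qed.

Lemma complementK r q f : labeling r q f -> complement q (complement q f) = f.
Proof.
move=> /labelingP[lt_q _]; apply/ffunP => x; rewrite !ffunE.
by have := lt_q x; lia.
Qed.

Definition demotion r q f := complement q (promotion (dual r) q (complement q f)).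

(** An element slides in the dual exactly when it slid forward: its new label is then 0 or was
    handed over from below, and its old label is found again at the element above that took it, or
    was [q - 1]. *)
Lemma promotionK r q f : labeling r q f -> demotion r q (promotion r q f) = f.
Proof.
move=> lab_f; have lab_p := promotion_labeling lab_f.
rewrite -[RHS](complementK lab_f) /demotion; congr (complement q _); apply/esym.
have [f_lt f_inc] := labelingP _ _ _ lab_f; have [p_lt p_inc] := labelingP _ _ _ lab_p.
have upper := promotion_ge lab_f.
have pE x : promotion r q f x =
    if sliding r q f x then floor_label r f x else (f x).+1 by rewrite ffunE.
apply: promotion_unique; first exact: complement_labeling lab_p.
move: (promotion r q f) lab_p p_lt p_inc upper pE => p lab_p p_lt p_inc upper pE x.
rewrite !ffunE.
have -> : (q - (p x).+1).+1 = q - p x by have := p_lt x; lia.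
have allE : [forall y, dual r x y ==> (complement q f y != q - p x)] =
            [forall y, r y x ==> ((f y).+1 != p x)].
  apply: eq_forallb => y; rewrite /dual; case: (boolP (r y x)) => //= ryx.
  by rewrite ffunE; have := f_lt y; have := p_lt x; lia.
rewrite allE.
have [sx|nsx] := boolP (sliding r q f x); last first.
  have Epx : p x = (f x).+1 by rewrite pE (negbTE nsx).
  rewrite Epx; have := p_lt x; rewrite Epx => ltq; rewrite ifT; first by lia.
  apply/andP; split; first by lia.
  by apply/forallP => y; apply/implyP => /f_inc; lia.
have Epx : p x = floor_label r f x by rewrite pE sx.
rewrite ifF; last first.
  apply/negP => /andP[lt0 /forallP all0].
  have [E|[z rzx E]] := floor_label_attained r f x; first by move: lt0; lia.
  by have := all0 z; rewrite rzx Epx E eqxx.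
apply/eqP; rewrite eqn_leq; apply/andP; split; last first.
  apply: floor_label_le => y rxy; rewrite ffunE.
  by have := upper _ _ rxy; have := p_lt y; lia.
case/slidingP: sx => [<-|[y [rxy sy E]]]; first by rewrite subnn.
have := floor_label_ge (complement q p) (rxy : dual r y x).
have Epy : p y = (f x).+1 by rewrite pE sy.
by rewrite ffunE Epy; have := p_lt y; rewrite Epy; lia.
Qed.

End Promotion.

(** * Packed labelings, and promotion against promotion of the dual *)

Section PackedLabelings.
Variable T : finType.
Implicit Types (r : rel T) (f g : {ffun T -> nat}) (x y z : T) (k : nat).

Definition packed r k g := labeling r k g && [forall j : 'I_k, exists x, g x == j].

Lemma packedP r k g :
  reflect (labeling r k g /\ forall j, j < k -> exists x, g x = j) (packed r k g).
Proof.
apply: (iffP andP) => -[lab h]; split=> //.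
  move=> j ltj.
  by have /forallP/(_ (Ordinal ltj))/existsP[x /eqP] := h; exists x.
by apply/forallP => j; have [x xj] := h j (ltn_ord j); apply/existsP; exists x; apply/eqP.
Qed.

Lemma packed_card r k g : packed r k g -> k <= #|T|.
Proof.
case/packedP => _ onto; rewrite cardE -(size_map g) -(size_iota 0 k).
apply: uniq_leq_size (iota_uniq _ _) _ => j; rewrite mem_iota add0n => /onto[x <-].
by apply: map_f; rewrite mem_enum.
Qed.

(** Recovers [k] from a packed labeling, so that one map can serve all [k]. *)
Definition height g : nat := \max_x (g x).+1.

Lemma packed_height r k g : packed r k g -> height g = k.
Proof.
case/packedP => /labelingP[ltk _] onto; apply/eqP; rewrite eqn_leq.
apply/andP; split; first by apply/bigmax_leqP => x _.
case: k ltk onto => // k ltk /(_ k (ltnSn k))[x <-].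
exact: (@leq_bigmax _ (fun x => (g x).+1)).
Qed.

Lemma packed_complement r k g : packed r k g -> packed (dual r) k (complement k g).
Proof.
case/packedP => lab onto; apply/packedP; split; first exact: complement_labeling.
move=> j ltj; have [|x xj] := onto (k - j.+1); first by lia.
by exists x; rewrite ffunE xj; lia.
Qed.

(** In a sliding element of least label nothing can come up from below, since the source would slide
    as well and have a smaller label. *)
Lemma sliding_floor0 r k g : 0 < k -> packed r k g ->
  exists2 x, sliding r k g x & floor_label r g x = 0.
Proof.
move=> k_gt0 /packedP[lab onto].
have [|t tk] := onto k.-1; first by lia.
have st : sliding r k g t by apply/slidingP; left; lia.
case: (@arg_minnP _ t (sliding r k g) g st) => x sx min; exists x => //.
have [//|[z rzx E]] := floor_label_attained r g x.
have /min : sliding r k g z by apply/slidingP; right; exists x.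
by have /labelingP[_ /(_ _ _ rzx)] := lab; lia.
Qed.

Lemma packed_promotion r k g : packed r k g -> packed r k (promotion r k g).
Proof.
move=> pg; have /packedP[lab onto] := pg.
apply/packedP; split=> [|[|j] ltj]; first exact: promotion_labeling.
  by have [x sx E] := sliding_floor0 ltj pg; exists x; rewrite ffunE sx.
have [|x xj] := onto j; first by lia.
have [/slidingP[E|[y [_ sy E]]]|nsx] := boolP (sliding r k g x); first by lia.
- by exists y; rewrite ffunE sy E xj.
- by exists x; rewrite ffunE (negbTE nsx) xj.
Qed.

(** [phi] is the involution that conjugates promotion to its inverse, followed by complementation,
    which carries inverse promotion for [r] to promotion for the dual. *)
Lemma packed_dual_conjugate r :
  exists phi psi : {ffun T -> nat} -> {ffun T -> nat}, forall k,
    (forall g, packed r k g -> [/\ packed (dual r) k (phi g), psi (phi g) = g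
        & phi (promotion r k g) = promotion (dual r) k (phi g)]) /\
    (forall g, packed (dual r) k g -> packed r k (psi g) /\ phi (psi g) = g).
Proof.
(* Packed labelings of all heights together: by [packed_card] their values are bounded by [#|T|], so
   they form a finite list. *)
pose l := [seq g <- [seq [ffun x => val (h x)] | h : {ffun T -> 'I_#|T|.+1}]
               | packed r (height g) g].
pose a g := promotion r (height g) g; pose b g := demotion r (height g) g.
have lP k g : packed r k g -> g \in l.
  move=> pg; rewrite mem_filter (packed_height pg) pg; apply/mapP.
  exists [ffun x => inord (g x)]; first by rewrite mem_enum.
  apply/ffunP => x; rewrite !ffunE /= inordK // ltnS.
  apply: leq_trans (packed_card pg); apply: ltnW.
  by case/packedP: pg => /labelingP[].
have lE g : g \in l -> packed r (height g) g by rewrite mem_filter => /andP[].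
have aE k g : packed r k g -> a g = promotion r k g by rewrite /a => /packed_height->.
have al : {in l, forall g, a g \in l}.
  by move=> g /lE/packed_promotion; apply: lP.
have ab : {in l, cancel a b}.
  move=> g /lE pg; rewrite /b (packed_height (packed_promotion pg)).
  by rewrite promotionK //; case/packedP: pg.
have [phi0 phi0P] := conjugate_to_inverse al ab.
have phi0_packed k g : packed r k g -> packed r k (phi0 g).
  move=> pg; have [_ _ _ [n ->]] := phi0P _ (lP _ _ pg).
  by elim: n => //= n IHn; rewrite (aE _ _ IHn) packed_promotion.
have phi0K k g : packed r k g -> phi0 (phi0 g) = g.
  by move=> pg; have [] := phi0P _ (lP _ _ pg).
have compl k g : packed (dual r) k g -> packed r k (complement k g).
  exact: packed_complement.
exists (fun g => complement (height g) (phi0 g)), (fun g => phi0 (complement (height g) g)).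
move=> k; split=> g pg; last first.
  rewrite (packed_height pg); split; first exact/phi0_packed/compl.
  rewrite (packed_height (phi0_packed _ _ (compl _ _ pg))) (phi0K k) ?compl //.
  by rewrite (@complementK _ (dual r)) //; case/packedP: pg.
have pg0 := phi0_packed _ _ pg; have pc := packed_complement pg0.
rewrite (packed_height pg) (packed_height pc); split=> //.
  rewrite (@complementK _ r) ?(phi0K k) //.
  by case/packedP: pg0.
rewrite (packed_height (packed_promotion pg)) -(aE _ _ pg).
have [_ _ -> _] := phi0P _ (lP _ _ pg).
rewrite /b (packed_height pg0) /demotion (@complementK _ (dual r)) //.
by apply: promotion_labeling; case/packedP: pc.
Qed.

End PackedLabelings.

(** * Promotion and modules *)

Definition is_module (T : finType) (r : rel T) (M : {set T}) : Prop :=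
  forall x y z, x \notin M -> y \in M -> z \in M -> r x y = r x z /\ r y x = r z x.

(** * The action of promotion on a labeling split along a module *)

Section Glue.
Variables (T : finType) (M : {set T}).
Local Notation S := {x : T | x \in M}.
Implicit Types (s : nat -> nat) (o f : {ffun T -> nat}) (g : {ffun S -> nat}).

Definition glue s o g : {ffun T -> nat} :=
  [ffun x => if insub x is Some u then s (g u) else o x].

Lemma glue_in s o g (u : S) : glue s o g (val u) = s (g u).
Proof. by rewrite ffunE valK. Qed.

Lemma glue_out s o g x : x \notin M -> glue s o g x = o x.
Proof. by move=> xM; rewrite ffunE insubN. Qed.

Lemma glueP s o g f :
  (forall u : S, f (val u) = s (g u)) -> {in [predC M], f =1 o} -> f = glue s o g.
Proof.
move=> fin fout; apply/ffunP => x; have [xM|xM] := boolP (x \in M).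
  by rewrite -[x]/(val (exist _ x xM : S)) glue_in fin.
by rewrite glue_out // fout.
Qed.

Section OneSystem.
Variables (r : rel T) (rS : rel S) (q k : nat) (s : nat -> nat) (o : {ffun T -> nat}).
Variables (g : {ffun S -> nat}) (m : T).
Hypotheses (rSE : forall u v : S, r (val u) (val v) = rS u v).
Hypotheses (modM : is_module r M) (mM : m \in M).
Hypotheses (s_inc : forall i j, i < j -> j < k -> s i < s j).
Hypotheses (pg : packed rS k g) (lab : labeling r q (glue s o g)).
Local Notation f := (glue s o g).

Let g_lt u : g u < k. Proof. by case/packedP: pg => /labelingP[]. Qed.
Let g_inc u v : rS u v -> g u < g v.
Proof. by case/packedP: pg => /labelingP[_ h] _; apply: h. Qed.
Let g_onto j : j < k -> exists u, g u = j. Proof. by case/packedP: pg => _; apply. Qed.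
Let f_lt x : f x < q. Proof. by case/labelingP: lab. Qed.
Let f_inc x y : r x y -> f x < f y. Proof. by case/labelingP: lab => _; apply. Qed.
Let k_gt0 : 0 < k. Proof. exact: leq_ltn_trans (g_lt (exist _ m mM : S)). Qed.

Let s_le i j : i <= j -> j < k -> s i <= s j.
Proof. by rewrite leq_eqVlt => /predU1P[-> //|lt_ij /(s_inc lt_ij)/ltnW]. Qed.

Let s_leE i j : i < k -> j < k -> (s i <= s j) = (i <= j).
Proof.
move=> ik jk; case: (leqP i j) => [le_ij|lt_ji]; first exact: s_le.
by apply/negbTE; rewrite -ltnNge s_inc.
Qed.

Let s_inj i j : i < k -> j < k -> s i = s j -> i = j.
Proof.
by move=> ik jk E; apply/eqP; rewrite eqn_leq -(s_leE ik jk) -(s_leE jk ik) E leqnn.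
Qed.

Let modL x (u v : S) : x \notin M -> r x (val u) = r x (val v).
Proof. by move=> xM; case: (modM xM (valP u) (valP v)). Qed.

Let modR x (u v : S) : x \notin M -> r (val u) x = r (val v) x.
Proof. by move=> xM; case: (modM xM (valP u) (valP v)). Qed.

Let m' : S := exist _ m mM.
Let M_val x : x \in M -> exists u : S, x = val u.
Proof. by move=> xM; exists (exist _ x xM). Qed.

(** For a module the choice of [m] in [M] does not affect this value. *)
Definition module_floor : nat := \max_(z | (z \notin M) && r z m) (o z).+1.

(** Losing its largest label and incrementing the others frees position 0, which the outside fills
    with [module_floor]; hence the index shift. *)
Definition refilled j : nat := if j is i.+1 then (s i).+1 else module_floor.

(** The largest label of [M] is deleted or is pulled up by an outside element. No other label of [M]
    can be pulled up, because an outside element above one member of [M] is above all of them. *)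
Definition activated : bool := ((s k.-1).+1 == q) ||
  [exists y, [&& y \notin M, r m y, sliding r q f y & floor_label r f y == (s k.-1).+1]].

Lemma below_module x (u : S) j : x \notin M -> r x (val u) -> j < k -> f x < s j.
Proof.
move=> xM rxu ltj; apply: (@leq_trans (s 0)); last exact: s_le.
have [v gv] := g_onto k_gt0.
by rewrite -gv -(glue_in s o) f_inc // (modL v u).
Qed.

Lemma floor_glue (u : S) : floor_label r f (val u) = refilled (floor_label rS g u).
Proof.
have [E0|[v rvu E]] := floor_label_attained rS g u; last first.
  rewrite -E /=; apply/eqP; rewrite eqn_leq; apply/andP; split; last first.
    by rewrite -(glue_in s o); apply: floor_label_ge; rewrite rSE.
  apply: floor_label_le => z; have [zM|zM] := boolP (z \in M); last first.
    by move=> /(below_module zM)/(_ (g_lt v)) ?; lia.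
  have [w ->] := M_val zM; rewrite rSE glue_in ltnS => /(floor_label_ge g).
  by rewrite -E ltnS => h; apply: s_le.
rewrite E0 /= /floor_label /module_floor (eq_bigl (fun z => (z \notin M) && r z m)).
  by apply: eq_bigr => z /andP[zM _]; rewrite glue_out.
move=> z; have [zM|zM] /= := boolP (z \in M); last by rewrite (modL u m').
have [v ->] := M_val zM; rewrite rSE; apply/negP => /(floor_label_ge g).
by rewrite E0.
Qed.

Lemma refilled_lt i j : i < j -> j < k -> refilled i < refilled j.
Proof.
case: j => // j; case: i => [_ ltj|i ltij ltj] /=; last by rewrite ltnS s_inc // ltnW.
rewrite ltnS; apply/bigmax_leqP => z /andP[zM rzm].
by have := below_module zM (rzm : r z (val m')) (ltnW ltj); rewrite glue_out.
Qed.

(** Induction from the top of [M] downwards. A slide from outside strikes exactly the elements of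
    packed label [k.-1], where packed promotion starts too; inside [M] floors correspond through the
    strictly increasing [s]. *)
Lemma sliding_glue (u : S) :
  sliding r q f (val u) = activated && sliding rS k g u.
Proof.
have qk : s k.-1 < q.
  by have [|v <-] := g_onto (_ : k.-1 < k); [lia | rewrite -(glue_in s o)].
have closer (u1 v1 : S) : rS u1 v1 -> k - g v1 < k - g u1.
  by move=> /g_inc; have := g_lt v1; lia.
have [n] := ubnP (k - g u); elim: n u => // n IHn u le_n.
have top : s k.-1 <= s (g u) -> (g u).+1 = k.
  by rewrite s_leE //; have := g_lt u; lia.
apply/idP/andP.
- case/slidingP => [E|[y [ruy sy E]]].
    have : (g u).+1 = k by apply: top; rewrite -(glue_in s o); lia.
    move=> Eu; split; last by apply/slidingP; left.
    by rewrite /activated -E -Eu /= glue_in eqxx.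
  have [yM|yM] := boolP (y \in M); last first.
    have rmy : r m y by rewrite (modR m' u).
    have Eu : (g u).+1 = k.
      apply: top; have [|v gv] := g_onto (_ : k.-1 < k); first by lia.
      rewrite -ltnS -(glue_in s o) -E -gv -(glue_in s o); apply: floor_label_ge.
      by rewrite (modR v u).
    split; last by apply/slidingP; left.
    apply/orP; right; apply/existsP; exists y; rewrite yM rmy sy E glue_in.
    by rewrite -Eu eqxx.
  have [w Ew] := M_val yM; subst y; rewrite rSE in ruy.
  have := sy; rewrite IHn; last exact: leq_trans (closer _ _ ruy) le_n.
  case/andP=> -> sw; split=> //; apply/slidingP; right; exists w; split=> //.
  move: E; rewrite floor_glue glue_in; have := floor_label_ge g ruy.
  case Ej : (floor_label rS g w) => [//|j] /= ltj [/s_inj->] //.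
  apply: ltn_trans (g_lt w); rewrite -Ej.
  by apply: floor_label_le_label; case/packedP: pg => h _; exact: h.
- case=> act /slidingP[Eu|[w [ruw sw E]]]; last first.
    apply/slidingP; right; exists (val w); rewrite rSE IHn; last first.
      exact: leq_trans (closer _ _ ruw) le_n.
    by rewrite act sw floor_glue E glue_in.
  have Ek : k.-1 = g u by rewrite -Eu.
  case/orP: act => [/eqP|/existsP[y /and4P[yM rmy sy /eqP]]]; rewrite Ek => E.
    by apply/slidingP; left; rewrite glue_in.
  apply/slidingP; right; exists y; split=> //; first by rewrite (modR u m').
  by rewrite E glue_in.
Qed.

Lemma promotion_glue : promotion r q f =
  glue (if activated then refilled else succn \o s) (promotion r q f)
       (if activated then promotion rS k g else g).
Proof.
apply: glueP => // u; rewrite ffunE sliding_glue.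
case: (boolP activated) => _ /=; last by rewrite glue_in.
rewrite [in RHS]ffunE; case: ifP => su; first exact: floor_glue.
by rewrite glue_in.
Qed.

(** A slide that crosses [M] leaves it at a sliding element of packed floor 0, and [sliding_floor0]
    provides one for every [g]. So the crossing case involves [g] only through [activated]. *)
Lemma sliding_outsideP x : x \notin M -> reflect
  [\/ (o x).+1 = q,
      exists y, [/\ y \notin M, r x y, sliding r q f y & floor_label r f y = (o x).+1]
    | [/\ r x m, activated & module_floor = (o x).+1]]
  (sliding r q f x).
Proof.
move=> xM; apply: (iffP idP) => [/slidingP|]; rewrite -(glue_out s o g xM).
- case=> [->|[y [rxy sy E]]]; first by constructor 1.
  have [yM|yM] := boolP (y \in M); last by constructor 2; exists y.
  have [u Eu] := M_val yM; subst y; constructor 3; split.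
  + by rewrite (modL m' u).
  + by move: sy; rewrite sliding_glue => /andP[].
  + move: E; rewrite floor_glue; case Ej: (floor_label rS g u) => [//|j] /= [E].
    have ltj : j < k.
      apply: leq_trans (ltnW (g_lt u)); rewrite -Ej.
      by apply: floor_label_le_label; case/packedP: pg => h _; exact: h.
    by have := below_module xM rxy ltj; rewrite -E ltnn.
- case=> [E|[y [_ rxy sy E]]|[rxm act E]]; apply/slidingP; first by left.
    by right; exists y.
  have [u su Eu] := sliding_floor0 k_gt0 pg.
  right; exists (val u); rewrite (modL u m') // sliding_glue act su.
  by rewrite floor_glue Eu.
Qed.

End OneSystem.
End Glue.

(** * Exchanging the packed labeling and the order on a module *)

Section TwoOrientations.
Variables (T : finType) (M : {set T}).
Local Notation S := {x : T | x \in M}.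

Section Compare.
Variables (r r2 : rel T) (rS rS2 : rel S) (q k : nat) (s : nat -> nat).
Variables (o : {ffun T -> nat}) (g g2 : {ffun S -> nat}) (m : T).
Hypotheses (rSE : forall u v : S, r (val u) (val v) = rS u v).
Hypotheses (rSE2 : forall u v : S, r2 (val u) (val v) = rS2 u v).
Hypotheses (modM : is_module r M) (modM2 : is_module r2 M) (mM : m \in M).
Hypothesis agree : forall x y, (x \notin M) || (y \notin M) -> r x y = r2 x y.
Hypotheses (s_inc : forall i j, i < j -> j < k -> s i < s j).
Hypotheses (pg : packed rS k g) (pg2 : packed rS2 k g2).

(** Comparisons with the outside depend only on the set of values on [M], and [g] and [g2] both take
    every value below [k]. *)
Lemma glue_labeling : labeling r q (glue s o g) -> labeling r2 q (glue s o g2).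
Proof.
move=> /labelingP[lt_q inc].
have common (u : S) : exists2 v : S, g v = g2 u & glue s o g2 (val u) = glue s o g (val v).
  have /packedP[/labelingP[ltk _] _] := pg2; have /packedP[_ onto] := pg.
  by have [v gv] := onto _ (ltk u); exists v; rewrite // !glue_in gv.
apply/labelingP; split=> [x|x y].
  have [xM|xM] := boolP (x \in M); last by rewrite glue_out // -(glue_out s o g xM).
  by have [v _ /= ->] := common (exist _ x xM).
have [xM|xM] := boolP (x \in M); have [yM|yM] := boolP (y \in M).
- pose u : S := exist _ x xM; pose v : S := exist _ y yM.
  rewrite -[x]/(val u) -[y]/(val v) rSE2 !glue_in.
  by case/packedP: pg2 => /labelingP[ltk h] _ /h /s_inc; apply.
- have [v _ /= ->] := common (exist _ x xM).
  rewrite (glue_out s o g2 yM) -(glue_out s o g yM) -agree ?yM ?orbT // => rxy.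
  by apply: inc; case: (modM yM (valP v) xM) => _ ->.
- have [v _ /= ->] := common (exist _ y yM).
  rewrite (glue_out s o g2 xM) -(glue_out s o g xM) -agree ?xM // => rxy.
  by apply: inc; case: (modM xM (valP v) yM) => ->.
- by rewrite !glue_out // -agree ?xM // => /inc; rewrite !glue_out.
Qed.

Lemma floor_outside_le x : x \notin M ->
  floor_label r (glue s o g) x <= floor_label r2 (glue s o g2) x.
Proof.
move=> xM; apply: floor_label_le => z rzx; have [zM|zM] := boolP (z \in M).
  have /packedP[/labelingP[ltk _] _] := pg; have /packedP[_ onto] := pg2.
  pose u : S := exist _ z zM; have [v gv] := onto _ (ltk u).
  rewrite -[z]/(val u) glue_in -gv -(glue_in s o); apply: floor_label_ge.
  by rewrite -agree ?xM ?orbT //; case: (modM xM (valP v) zM) => _ ->.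
rewrite (glue_out s o g zM) -(glue_out s o g2 zM); apply: floor_label_ge.
by rewrite -agree ?xM ?orbT.
Qed.

Lemma module_floorE : module_floor M r o m = module_floor M r2 o m.
Proof.
apply: eq_bigl => z; case: (boolP (z \in M)) => //= zM.
by rewrite agree ?zM.
Qed.

End Compare.

Section Outside.
Variables (r r2 : rel T) (rS rS2 : rel S) (q k : nat) (s : nat -> nat).
Variables (o : {ffun T -> nat}) (g g2 : {ffun S -> nat}) (m : T).
Hypotheses (rSE : forall u v : S, r (val u) (val v) = rS u v).
Hypotheses (rSE2 : forall u v : S, r2 (val u) (val v) = rS2 u v).
Hypotheses (modM : is_module r M) (modM2 : is_module r2 M) (mM : m \in M).
Hypothesis agree : forall x y, (x \notin M) || (y \notin M) -> r x y = r2 x y.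
Hypotheses (s_inc : forall i j, i < j -> j < k -> s i < s j).
Hypotheses (pg : packed rS k g) (pg2 : packed rS2 k g2).
Hypotheses (lab : labeling r q (glue s o g)) (lab2 : labeling r2 q (glue s o g2)).

Let agree' x y : (x \notin M) || (y \notin M) -> r2 x y = r x y.
Proof. by move/agree. Qed.

Lemma floor_outside x : x \notin M ->
  floor_label r (glue s o g) x = floor_label r2 (glue s o g2) x.
Proof.
move=> xM; apply/eqP; rewrite eqn_leq; apply/andP; split.
  exact: (floor_outside_le s o modM agree pg pg2).
exact: (floor_outside_le s o modM2 agree' pg2 pg).
Qed.

Lemma activated_mono :
  (forall y, y \notin M -> r m y -> sliding r q (glue s o g) y ->
     sliding r2 q (glue s o g2) y) ->
  activated r q k s o g m -> activated r2 q k s o g2 m.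
Proof.
move=> h /orP[E|/existsP[y /and4P[yM rmy sy E]]]; apply/orP; [by left | right].
by apply/existsP; exists y; rewrite yM -agree ?yM ?orbT // rmy h // -floor_outside.
Qed.

(** Sliding below [M] depends on activation, which depends on sliding above [M]. Induction on
    [q - o x] breaks the circle, since elements above [M] carry larger labels than those below
    it. *)
Lemma sliding_outside_mono x : x \notin M ->
  sliding r q (glue s o g) x -> sliding r2 q (glue s o g2) x.
Proof.
have [lt_q inc] := labelingP _ _ _ lab.
have [n] := ubnP (q - o x); elim: n x => // n IHn x le_n xM.
have up y : y \notin M -> r x y -> q - o y < n.
  move=> yM /inc; rewrite !glue_out // => ?.
  by have := lt_q y; rewrite glue_out //; lia.
move=> /(sliding_outsideP rSE modM mM s_inc pg lab xM) sx.
apply/(sliding_outsideP rSE2 modM2 mM s_inc pg2 lab2 xM).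
case: sx => [E|[y [yM rxy sy E]]|[rxm act E]]; first by constructor 1.
  constructor 2; exists y; rewrite -agree ?xM // -floor_outside //; split=> //.
  by apply: IHn; rewrite // up.
constructor 3; rewrite -agree ?xM // -(module_floorE o m agree); split=> //.
apply: activated_mono act => y yM rmy; apply: IHn => //.
have := inc _ _ rxm; have := inc _ _ rmy; have := lt_q y.
by rewrite (glue_out s o g xM) (glue_out s o g yM); lia.
Qed.

End Outside.

Section Substitution.
Variables (r r2 : rel T) (rS rS2 : rel S) (q k : nat) (s : nat -> nat).
Variables (o : {ffun T -> nat}) (g g2 : {ffun S -> nat}) (m : T).
Hypotheses (rSE : forall u v : S, r (val u) (val v) = rS u v).
Hypotheses (rSE2 : forall u v : S, r2 (val u) (val v) = rS2 u v).
Hypotheses (modM : is_module r M) (modM2 : is_module r2 M) (mM : m \in M).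
Hypothesis agree : forall x y, (x \notin M) || (y \notin M) -> r x y = r2 x y.
Hypotheses (s_inc : forall i j, i < j -> j < k -> s i < s j).
Hypotheses (pg : packed rS k g) (pg2 : packed rS2 k g2).
Hypotheses (lab : labeling r q (glue s o g)).

(* Promotion acts on the labels outside M and on the set of labels of M without
   looking at the packed labeling g, which is itself promoted or kept. *)
Lemma promotion_substitution :
  exists (b : bool) (s' : nat -> nat) (o' : {ffun T -> nat}),
    [/\ forall i j, i < j -> j < k -> s' i < s' j,
        promotion r q (glue s o g) = glue s' o' (if b then promotion rS k g else g)
      & promotion r2 q (glue s o g2) =
          glue s' o' (if b then promotion rS2 k g2 else g2)].
Proof.
have lab2 := glue_labeling rSE2 modM agree s_inc pg pg2 lab.
have agree2 x y : (x \notin M) || (y \notin M) -> r2 x y = r x y by move/agree.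
have sE x : x \notin M ->
    sliding r q (glue s o g) x = sliding r2 q (glue s o g2) x.
  move=> xM; apply/idP/idP.
    exact: (sliding_outside_mono rSE rSE2 modM modM2 mM agree s_inc pg pg2 lab lab2).
  exact: (sliding_outside_mono rSE2 rSE modM2 modM mM agree2 s_inc pg2 pg lab2 lab).
have actE : activated r q k s o g m = activated r2 q k s o g2 m.
  apply/idP/idP.
    by apply: (activated_mono modM modM2 agree pg pg2) => y /sE->.
  by apply: (activated_mono modM2 modM agree2 pg2 pg) => y /sE->.
exists (activated r q k s o g m), (if activated r q k s o g m
  then refilled M r s o m else succn \o s), (promotion r q (glue s o g)); split.
- case: ifP => _ i j ltij ltj; last by rewrite /= ltnS s_inc.
  exact: (refilled_lt modM mM s_inc pg lab).
- exact: (promotion_glue rSE modM mM s_inc pg lab).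
- rewrite (promotion_glue rSE2 modM2 mM s_inc pg2 lab2) -actE.
  apply: glueP => [u|x xM]; last first.
    rewrite glue_out // /promotion ffunE [RHS]ffunE sE // (floor_outside s o modM modM2 agree pg pg2) //.
    by rewrite !glue_out.
  by rewrite glue_in /refilled (module_floorE o m agree).
Qed.

End Substitution.

End TwoOrientations.

(** * Uniqueness of the splitting of a labeling *)

Section Pack.
Variables (T : finType) (M : {set T}) (q : nat).
Local Notation S := {x : T | x \in M}.
Implicit Types (s : nat -> nat) (o f : {ffun T -> nat}) (g : {ffun S -> nat}).

Definition labels f : seq nat := [seq l <- iota 0 q | [exists u : S, f (val u) == l]].

Definition pack f : {ffun S -> nat} := [ffun u => index (f (val u)) (labels f)].

Lemma labels_sorted f : sorted ltn (labels f).
Proof. exact: sorted_filter ltn_trans _ _ (iota_ltn_sorted 0 q). Qed.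

Lemma nth_labels_lt f i j : i < j -> j < size (labels f) ->
  nth 0 (labels f) i < nth 0 (labels f) j.
Proof.
move=> ltij ltj; apply: (sorted_ltn_nth ltn_trans 0 (labels_sorted f)) => //.
exact: ltn_trans ltj.
Qed.

Lemma nth_labels_ltE f i j : i < size (labels f) -> j < size (labels f) ->
  (nth 0 (labels f) i < nth 0 (labels f) j) = (i < j).
Proof.
move=> lti ltj; case: (ltngtP i j) => [ltij|ltji|->]; last by rewrite ltnn.
  exact: nth_labels_lt.
by apply/negbTE; rewrite -leqNgt ltnW // nth_labels_lt.
Qed.

Section Packing.
Variables (r : rel T) (rS : rel S) (f : {ffun T -> nat}).
Hypothesis rSE : forall u v : S, r (val u) (val v) = rS u v.
Hypothesis lab : labeling r q f.

Let mem_labels (u : S) : f (val u) \in labels f.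
Proof.
have /labelingP[lt_q _] := lab; rewrite mem_filter mem_iota /= add0n lt_q andbT.
by apply/existsP; exists u.
Qed.

Lemma pack_packed : packed rS (size (labels f)) (pack f).
Proof.
have /labelingP[lt_q inc] := lab; apply/packedP; split=> [|j ltj].
  apply/labelingP; split=> [u|u v]; first by rewrite ffunE index_mem.
  rewrite -rSE => /inc lt_uv; rewrite !ffunE -(@nth_labels_ltE f) ?index_mem //.
  by rewrite !nth_index.
have := mem_nth 0 ltj; rewrite mem_filter => /andP[/existsP[u /eqP E] _].
exists u; rewrite ffunE E index_uniq //.
by apply: (sorted_uniq ltn_trans ltnn); apply: labels_sorted.
Qed.

Lemma packK : glue (nth 0 (labels f)) f (pack f) = f.
Proof. by apply/esym/glueP => // u; rewrite ffunE nth_index. Qed.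

End Packing.

Section Uniqueness.
Variables (r : rel T) (rS : rel S) (k : nat) (s : nat -> nat) (o : {ffun T -> nat}).
Variable g : {ffun S -> nat}.
Hypotheses (s_inc : forall i j, i < j -> j < k -> s i < s j).
Hypotheses (pg : packed rS k g) (lab : labeling r q (glue s o g)).

(** A strictly increasing list is determined by its members, so [s] below [k], and then [g], can be
    read off the glued labeling. *)
Lemma labels_glue : labels (glue s o g) = [seq s j | j <- iota 0 k].
Proof.
have /packedP[/labelingP[ltk _] onto] := pg; have /labelingP[lt_q _] := lab.
apply: (irr_sorted_eq ltn_trans ltnn); first exact: labels_sorted.
  rewrite sorted_map (@sub_in_sorted _ (gtn k) ltn) ?iota_ltn_sorted //.
    by move=> i j _ ltj ltij; apply: s_inc.
  by apply/allP => j; rewrite mem_iota.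
move=> l; rewrite mem_filter mem_iota add0n.
apply/andP/mapP => [[/existsP[u /eqP <-] _]|[j]].
  by exists (g u); rewrite ?glue_in // mem_iota ltk.
rewrite mem_iota => /onto[u <-] ->; split; last by rewrite /= -(glue_in s o).
by apply/existsP; exists u; rewrite glue_in.
Qed.

Lemma size_labels_glue : size (labels (glue s o g)) = k.
Proof. by rewrite labels_glue size_map size_iota. Qed.

Lemma nth_labels_glue j : j < k -> nth 0 (labels (glue s o g)) j = s j.
Proof. by move=> ltj; rewrite labels_glue (nth_map 0) ?size_iota // nth_iota. Qed.

Lemma pack_glue : pack (glue s o g) = g.
Proof.
have /packedP[/labelingP[ltk _] _] := pg; apply/ffunP => u.
rewrite ffunE glue_in -nth_labels_glue // index_uniq ?size_labels_glue //.
by apply: (sorted_uniq ltn_trans ltnn); apply: labels_sorted.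
Qed.

End Uniqueness.

Lemma eq_glue s s2 o o2 g k : (forall u, g u < k) -> (forall j, j < k -> s j = s2 j) ->
  {in [predC M], o =1 o2} -> glue s o g = glue s2 o2 g.
Proof.
move=> ltk sE oE; apply: glueP => [u|x xM]; first by rewrite glue_in sE.
by rewrite glue_out // oE.
Qed.

Definition repack (phi : {ffun S -> nat} -> {ffun S -> nat}) f : {ffun T -> nat} :=
  glue (nth 0 (labels f)) f (phi (pack f)).

Lemma repack_glue phi (r : rel T) (rS rS2 : rel S) k s o g :
  (forall i j, i < j -> j < k -> s i < s j) ->
  packed rS k g -> packed rS2 k (phi g) -> labeling r q (glue s o g) ->
  repack phi (glue s o g) = glue s o (phi g).
Proof.
move=> s_inc pg pg2 lab; rewrite /repack (pack_glue s_inc pg lab).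
apply: (@eq_glue _ _ _ _ _ k) => [u|j ltj|x xM].
- by case/packedP: pg2 => /labelingP[].
- exact: (nth_labels_glue s_inc pg lab).
- by rewrite glue_out.
Qed.

End Pack.

Definition conjugate (A B : Type) (V : pred A) (a : A -> A) (W : pred B) (b : B -> B) :=
  (forall x, V x -> V (a x)) /\ exists (h : A -> B) (h' : B -> A),
    (forall x, V x -> [/\ W (h x), h' (h x) = x & h (a x) = b (h x)]) /\
    (forall y, W y -> V (h' y) /\ h (h' y) = y).

Lemma conjugate_sym (A B : Type) (V : pred A) a (W : pred B) b :
  conjugate V a W b -> conjugate W b V a.
Proof.
case=> Va [h [h' [hP h'P]]]; have bE y : W y -> b y = h (a (h' y)).
  by move=> Wy; have [Vy <-] := h'P _ Wy; have [_ -> ->] := hP _ Vy.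
split=> [y Wy|].
  by rewrite bE //; have [Vy _] := h'P _ Wy; have [] := hP _ (Va _ Vy).
exists h', h; split=> [y Wy|x Vx]; last by have [] := hP _ Vx.
have [Vy hh] := h'P _ Wy; split=> //.
by rewrite bE //; have [] := hP _ (Va _ Vy).
Qed.

Lemma conjugate_trans (A B C : Type) (V : pred A) a (W : pred B) b (U : pred C) c :
  conjugate V a W b -> conjugate W b U c -> conjugate V a U c.
Proof.
case=> Va [h [h' [hP h'P]]] [Wb [k [k' [kP k'P]]]]; split=> //.
exists (k \o h), (h' \o k'); split=> [x Vx|z Uz] /=.
  have [Wx hx ha] := hP _ Vx; have [Ux kx kb] := kP _ Wx.
  by rewrite kx hx ha kb.
have [Wz kz] := k'P _ Uz; have [Vz hz] := h'P _ Wz.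
by rewrite hz.
Qed.

Definition promotion_conjugate (T : finType) (r r2 : rel T) : Prop :=
  forall q, conjugate (labeling r q) (promotion r q) (labeling r2 q) (promotion r2 q).

Lemma promotion_conjugate_sym (T : finType) (r r2 : rel T) :
  promotion_conjugate r r2 -> promotion_conjugate r2 r.
Proof. by move=> h q; apply: conjugate_sym. Qed.

Lemma promotion_conjugate_trans (T : finType) (r r2 r3 : rel T) :
  promotion_conjugate r r2 -> promotion_conjugate r2 r3 -> promotion_conjugate r r3.
Proof. by move=> h h' q; apply: conjugate_trans (h q) (h' q). Qed.

Lemma eq_labeling (T : finType) (r r2 : rel T) q f :
  r =2 r2 -> labeling r q f = labeling r2 q f.
Proof.
move=> rE; congr (_ && _); apply: eq_forallb => x; apply: eq_forallb => y.
by rewrite rE.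
Qed.

Lemma eq_promotion (T : finType) (r r2 : rel T) q f :
  r =2 r2 -> promotion r q f = promotion r2 q f.
Proof.
move=> rE; have fE x : floor_label r f x = floor_label r2 f x by apply: eq_bigl.
apply/ffunP => x; rewrite !ffunE fE /sliding; congr (if _ then _ else _).
apply: eq_existsb => y; congr (_ && _); apply: eq_connect => u v.
by rewrite /slide /= rE fE.
Qed.

Lemma eq_promotion_conjugate (T : finType) (r r2 : rel T) :
  r =2 r2 -> promotion_conjugate r r2.
Proof.
move=> rE q; split=> [f|]; first exact: promotion_labeling.
exists id, id; split=> f lab; split=> //; last 1 first.
- by rewrite (eq_labeling _ _ rE).
- by rewrite -(eq_labeling _ _ rE).
- exact: eq_promotion.
Qed.

Definition reverse_module (T : finType) (M : {set T}) (r : rel T) : rel T :=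
  fun x y => if (x \in M) && (y \in M) then r y x else r x y.

(** Apply [phi] to the packed labeling of [M] and leave everything else. By [promotion_substitution]
    both orders then produce the same new outside, the same new label set and the same choice
    between promoting and keeping; [phi] commutes with either choice. *)
Lemma reverse_module_conjugate (T : finType) (M : {set T}) (r : rel T) :
  is_module r M -> promotion_conjugate r (reverse_module M r).
Proof.
move=> modM q; have [->|[m mM]] := set_0Vmem M.
  by apply: eq_promotion_conjugate => x y; rewrite /reverse_module !inE.
pose S := {x : T | x \in M}; pose rS : rel S := fun u v => r (val u) (val v).
set r2 := reverse_module M r.
have agree x y : (x \notin M) || (y \notin M) -> r x y = r2 x y.
  by rewrite /r2 /reverse_module; case: (x \in M) => //=; case: (y \in M).
have rSE (u v : S) : r (val u) (val v) = rS u v by [].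
have rSE2 (u v : S) : r2 (val u) (val v) = dual rS u v.
  by rewrite /r2 /reverse_module (valP u) (valP v).
have modM2 : is_module r2 M.
  by move=> x y z xM yM zM; rewrite -!agree ?xM ?orbT //; apply: modM.
have agree2 x y : (x \notin M) || (y \notin M) -> r2 x y = r x y by move/agree.
have [phi [psi conj]] := packed_dual_conjugate rS.
have phiP k g pg := (conj k).1 g pg; have psiP k g pg := (conj k).2 g pg.
split; first by move=> f; apply: promotion_labeling.
exists (repack q phi), (repack q psi); split=> f lab.
- have pf := pack_packed rSE lab; have s_inc := @nth_labels_lt _ M q f.
  have [pg2 gK ga] := phiP _ _ pf.
  have labg : labeling r q (glue (nth 0 (labels M q f)) f (pack M q f)) by rewrite (packK M lab).
  have lab2 := glue_labeling rSE2 modM agree s_inc pf pg2 labg.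
  split=> //.
    have pf2 := pf; rewrite -gK in pf2.
    rewrite [repack q phi f]/repack (repack_glue s_inc pg2 pf2 lab2) gK.
    exact: (packK M lab).
  have [b [s' [o' [s'_inc E E2]]]] :=
    promotion_substitution rSE rSE2 modM modM2 mM agree s_inc pf pg2 labg.
  have labp := promotion_labeling labg.
  rewrite [repack q phi f in RHS]/repack E2; rewrite E in labp.
  move: E; rewrite (packK M lab) => ->.
  case: b labp {E2} => labp.
    have pp := packed_promotion pg2; rewrite -ga in pp.
    by rewrite (repack_glue s'_inc (packed_promotion pf) pp labp) ga.
  by rewrite (repack_glue s'_inc pf pg2 labp).
- have pf := pack_packed rSE2 lab; have s_inc := @nth_labels_lt _ M q f.
  have [pg2 gK] := psiP _ _ pf.
  have labg : labeling r2 q (glue (nth 0 (labels M q f)) f (pack M q f)) by rewrite (packK M lab).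
  have lab2 := glue_labeling rSE modM2 agree2 s_inc pf pg2 labg.
  split=> //.
  have pf2 := pf; rewrite -gK in pf2.
  rewrite [repack q psi f]/repack (repack_glue s_inc pg2 pf2 lab2) gK.
  exact: (packK M lab).
Qed.

(** * Transitive orientations of a graph *)

Section GallaiColouring.
Variables (T : finType) (col : T -> T -> 'I_3).
Hypothesis col_sym : forall x y, col x y = col y x.
Hypothesis no_rainbow : forall x y z, x != y -> y != z -> x != z ->
  [\/ col x y = col y z, col x z = col x y | col x z = col y z].

Definition colour_cut (W : {set T}) (i : 'I_3) (C : {set T}) : bool :=
  [&& C \subset W, C != set0, C != W & [forall x in C, forall y in W :\: C, col x y != i]].

Lemma colour_cutP (W : {set T}) i (C : {set T}) :
  reflect [/\ C \subset W, C != set0, C != W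
             & forall x y, x \in C -> y \in W -> y \notin C -> col x y != i]
          (colour_cut W i C).
Proof.
apply: (iffP and4P) => -[CW C0 CnW h]; split=> //.
  move=> x y xC yW yC; have /forall_inP/(_ x xC)/forall_inP/(_ y) := h.
  by apply; rewrite inE yC.
apply/forall_inP => x xC; apply/forall_inP => y; rewrite inE => /andP[yC yW].
exact: h.
Qed.

Lemma two_other_colours (i : 'I_3) : exists j k : 'I_3, [/\ j != i, k != i & j != k].
Proof.
pose c n := inord n : 'I_3.
have cE m n : m < 3 -> n < 3 -> (c m == c n) = (m == n).
  by move=> m3 n3; rewrite -val_eqE /= !inordK.
rewrite -[i]inord_val -/(c i); case: i => [[|[|[|//]]] /= _].
- by exists (c 1), (c 2); rewrite !cE.
- by exists (c 0), (c 2); rewrite !cE.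
- by exists (c 0), (c 1); rewrite !cE.
Qed.

(* Remove a vertex v and cut the rest along colour i.  If no colour were cut
   once v is back, then v would be joined in colour i to every i-component,
   and its edges in the two other colours would force two different colours
   on the edges between the same pair of i-components. *)
Lemma gallai_cut (W : {set T}) : 1 < #|W| -> exists i C, colour_cut W i C.
Proof.
have [n] := ubnP #|W|; elim: n W => // n IHn W le_n W1.
have [/existsP[i /existsP[C cut]]|nocut] :=
  boolP [exists i, exists C, colour_cut W i C]; first by exists i, C.
have conn j (C : {set T}) : C \subset W -> C != set0 -> C != W ->
    exists x y, [/\ x \in C, y \in W, y \notin C & col x y = j].
  move=> CW C0 CnW.
  have [/exists_inP[x xC /exists_inP[y]]|nex] :=
    boolP [exists x in C, exists y in W :\: C, col x y == j].
    by rewrite inE => /andP[yC yW] /eqP E; exists x, y.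
  case/negP: nocut; apply/existsP; exists j; apply/existsP; exists C.
  apply/colour_cutP; split=> // x y xC yW yC; apply: contra nex => E.
  by apply/exists_inP; exists x => //; apply/exists_inP; exists y; rewrite // inE yC.
have [v vW] : exists v, v \in W by apply/set0Pn; rewrite -card_gt0; lia.
pose V := W :\ v; have cardV : #|W| = #|V|.+1 by rewrite (cardsD1 v W) vW.
have VW : V \subset W by apply: subsetDl.
have colour_v j : exists2 w, w \in V & col v w = j.
  have [|||x [y [/set1P-> yW yv E]]] := conn j [set v]; rewrite ?sub1set //.
  - by apply/set0Pn; exists v; rewrite inE.
  - by apply: contraTneq W1 => <-; rewrite cards1.
  - by exists y => //; move: yv; rewrite !inE yW => ->.
(* With at most one vertex besides [v], two colours at [v] would have to lie on the same edge. *)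
have [V1|V1] := leqP #|V| 1.
  have [a aV Ea] := colour_v (inord 0); have [b bV Eb] := colour_v (inord 1).
  have /card_le1_eqP/(_ _ _ aV bV) Eab := V1.
  by move: Ea; rewrite -Eab Eb => /(congr1 val); rewrite /= !inordK.
have [|i [C /colour_cutP[CV C0 CnV cutC]]] := IHn V _ V1; first by lia.
pose e : rel T := fun x y => [&& x \in V, y \in V & col x y == i].
have e_sym : connect_sym e.
  by apply: sym_connect_sym => x y; rewrite /e col_sym andbCA.
have stepV x y : connect e x y -> x \in V -> y \in V.
  move=> cxy xV; rewrite -(@closed_connect _ e (mem V) _ x y) // => a b.
  by case/and3P=> /= -> ->.
(* Colour [i] does not cut [W], and inside [V] no edge of colour [i] leaves the component of [u]; so
   the component is left through [v]. *)
have to_v u : u \in V -> exists2 u1, connect e u u1 & col v u1 = i.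
  move=> uV; pose H := [set x in V | connect e u x].
  have HV : H \subset V by apply/subsetP => x; rewrite inE => /andP[].
  have [|||x [y []]] := conn i H.
  - exact: subset_trans VW.
  - by apply/set0Pn; exists u; rewrite inE uV connect0.
  - by apply: contraTneq vW => <-; rewrite !inE eqxx.
  rewrite !inE => /andP[xV cx] yW ncy E; exists x => //.
  have [<-|yv] := eqVneq y v; first by rewrite col_sym.
  case/negP: ncy; rewrite yv yW /=; apply: connect_trans cx (connect1 _).
  by rewrite /e !inE xV yv yW E eqxx.
(* For each edge of colour [i] in the component, the two edges joining it to [x] avoid [i], so
   [no_rainbow] makes them equal in colour. *)
have uniform x u u' : x \in V -> u \in V -> ~~ connect e u x -> connect e u u' ->
    col x u = col x u'.
  move=> xV uV nc /connectP[p]; elim: p u uV nc => [|w p IHp] u uV nc /=.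
    by move=> _ ->.
  case/andP=> euw pw Eu'; have /and3P[_ wV /eqP Euw] := euw.
  have ncw : ~~ connect e w x by apply: contra nc; apply: connect_trans (connect1 euw).
  rewrite -(IHp w) //.
  have [->//|uw] := eqVneq u w.
  have xu : x != u by apply: contraNneq nc => ->; apply: connect0.
  have xw : x != w by apply: contraNneq ncw => ->; apply: connect0.
  have nxu : col x u != i.
    by apply: contra nc => E; apply: connect1; rewrite /e uV xV col_sym E.
  have nxw : col x w != i.
    by apply: contra ncw => E; apply: connect1; rewrite /e wV xV col_sym E.
  case: (no_rainbow xu uw xw) => //; rewrite Euw => E.
    by rewrite E eqxx in nxu.
  by rewrite E eqxx in nxw.
(* In the triangle [v], [w], [u1] only the edge from [v] to [u1] has colour [i], so the other two
   share a colour; [uniform] moves [u1] back to [u]. *)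
have forced w u : w \in V -> u \in V -> col v w != i -> ~~ connect e w u ->
    col u w = col v w.
  move=> wV uV nvw nc; have [u1 cu1 Eu1] := to_v u uV.
  have nc1 : ~~ connect e w u1.
    by apply: contra nc => h; apply: connect_trans h _; rewrite e_sym.
  have u1V := stepV _ _ cu1 uV.
  rewrite col_sym (uniform w u u1) //; last by rewrite e_sym.
  have vw : v != w by apply: contraTneq wV => <-; rewrite !inE eqxx.
  have vu1 : v != u1 by apply: contraTneq u1V => <-; rewrite !inE eqxx.
  have wu1 : w != u1 by apply: contraNneq nc1 => ->; apply: connect0.
  have nwu1 : col w u1 != i.
    by apply: contra nc1 => E; apply: connect1; rewrite /e wV u1V E.
  case: (no_rainbow vw wu1 vu1) => //; rewrite Eu1 => E.
    by rewrite -E eqxx in nvw.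
  by rewrite -E eqxx in nwu1.
have [j [k [ji ki jk]]] := two_other_colours i.
have [w wV Ew] := colour_v j; have [w' w'V Ew'] := colour_v k.
(* In different components, [w] and [w'] would be joined in both colours [j] and [k]. In the same
   component, a [u] from another one is joined to [w] in [j] and to [w'] in [k], against
   [uniform]. *)
have [cww'|ncww'] := boolP (connect e w w'); last first.
  have := forced w w' wV w'V; rewrite Ew => /(_ ji ncww').
  have := forced w' w w'V wV; rewrite Ew' e_sym => /(_ ki ncww').
  by rewrite col_sym => -> E; rewrite E eqxx in jk.
have [u uV ncu] : exists2 u, u \in V & ~~ connect e w u.
  have [/exists_inP[u uV h]|all] := boolP [exists u in V, ~~ connect e w u].
    by exists u.
  have {}all u : u \in V -> connect e w u.
    by move=> uV; apply: contraNT all => h; apply/exists_inP; exists u.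
  have [a aC] := set0Pn _ C0; have aV := subsetP CV _ aC.
  have [b bV bC] : exists2 b, b \in V & b \notin C.
    by apply/subsetPn; apply: contra CnV => VC; rewrite eqEsubset CV.
  have cab : connect e a b by apply: connect_trans (all b bV); rewrite e_sym all.
  have : (a \in C) = (b \in C).
    apply: (@closed_connect _ e (mem C)) cab => x y /and3P[xV yV /eqP E] /=.
    apply/idP/idP => [xC|yC]; apply: contraT => nC.
      by have := cutC x y xC yV nC; rewrite E eqxx.
    by have := cutC y x yC xV nC; rewrite col_sym E eqxx.
  by rewrite aC (negbTE bC).
have ncu' : ~~ connect e w' u by apply: contra ncu; apply: connect_trans.
have := forced w u wV uV; rewrite Ew => /(_ ji ncu) E1.
have := forced w' u w'V uV; rewrite Ew' => /(_ ki ncu') E2.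
by move: jk; rewrite -E1 -E2 (uniform u w w') ?eqxx.
Qed.

End GallaiColouring.

(** * From cuts to reversals of modules *)

Section Orientations.
Variable T : finType.
Implicit Types (r : rel T) (C W : {set T}) (x y z : T).

Definition adjacent r : rel T := fun x y => r x y || r y x.

Definition replace_module W r r2 : rel T :=
  fun x y => if (x \in W) && (y \in W) then r2 x y else r x y.

Lemma strict_asym r x y : strict_order r -> r x y -> r y x = false.
Proof. by case=> irr tr rxy; apply/negP => /(tr _ _ _ rxy); rewrite irr. Qed.

(** For transitivity the mixed triples follow from the module property, except that a path leaving
    [W] and returning is impossible: from [r x y] and [r y z] with only [y] outside, the module
    property gives [r y x]. *)
Lemma replace_strict W r r2 : is_module r W -> strict_order r -> strict_order r2 ->
  strict_order (replace_module W r r2).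
Proof.
move=> modW [irr tr] [irr2 tr2]; split=> [x|y x z]; rewrite /replace_module.
  by rewrite irr irr2 if_same.
have [xW|xW] := boolP (x \in W); have [yW|yW] := boolP (y \in W);
  have [zW|zW] := boolP (z \in W) => //=; try exact: tr; try exact: tr2.
- by move=> _; case: (modW z x y zW xW yW) => _ ->.
- move=> rxy ryz; case: (modW y x z yW xW zW) => E _.
  by have := tr _ _ _ rxy ryz; rewrite -E in ryz; have := tr _ _ _ rxy ryz; rewrite irr.
- by move=> rxy _; case: (modW x y z xW yW zW) => <-.
Qed.

Lemma replace_adjacent W r r2 :
  adjacent r =2 adjacent r2 -> adjacent (replace_module W r r2) =2 adjacent r.
Proof.
move=> adj x y; rewrite {1}/adjacent /replace_module [in X in _ || X]andbC.
by case: ifP => // _; rewrite -[_ || _]/(adjacent r2 x y) adj.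
Qed.

Lemma dual_adjacent r : adjacent (dual r) =2 adjacent r.
Proof. by move=> x y; rewrite /adjacent /dual orbC. Qed.

Lemma replace_is_module W r r2 C :
  C \subset W -> is_module r W -> is_module (replace_module C r r2) W.
Proof.
move=> CW modW x y z xW yW zW; rewrite /replace_module.
have xC : (x \in C) = false by apply: contraNF xW; apply: (subsetP CW).
by rewrite xC !andbF /=; apply: modW.
Qed.

(** Invariance is asked only along edges reachable from [x], so that membership in the component is
    available when checking it. *)
Lemma connect_invariant (e : rel T) (a : pred T) x y :
  (forall u w, connect e x u -> e u w -> a u -> a w) -> a x -> connect e x y -> a y.
Proof.
move=> h ax /connectP[p pp ->].
have: forall u, a u -> connect e x u -> path e u p -> a (last u p).
  elim: p {pp} => //= w p IHp u au cu /andP[euw]; apply: IHp; first exact: h euw au.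
  exact: connect_trans cu (connect1 euw).
by apply=> //; apply: connect0.
Qed.

Section Step.
Variable W : {set T}.
Hypothesis IH : forall C r r2, #|C| < #|W| -> strict_order r -> strict_order r2 ->
  adjacent r =2 adjacent r2 -> is_module r C ->
  promotion_conjugate r (replace_module C r r2).

Definition agree_outside r r2 :=
  forall x y, (x \notin W) || (y \notin W) -> r x y = r2 x y.

(* A connected component of the graph of disagreements is a module of r; on
   each component r can be changed into r2 by the induction hypothesis. *)
Lemma disagreement_cut_conjugate C0 r r2 :
  strict_order r -> strict_order r2 -> adjacent r =2 adjacent r2 ->
  is_module r W -> agree_outside r r2 ->
  C0 \subset W -> C0 != set0 -> C0 != W ->
  (forall x y, x \in C0 -> y \in W -> y \notin C0 -> r x y = r2 x y) ->
  promotion_conjugate r r2.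
Proof.
(* The measure counts the pairs on which the orders differ. Replacing [r] by [r2] on a component
   removes such pairs and creates none, and the cut keeps each component within [C0] or away from
   it, hence smaller than [W]. *)
have [n] := ubnP #|[set p : T * T | r p.1 p.2 != r2 p.1 p.2]|.
elim: n r => // n IHn r le_n st st2 adj modW out C0W C0n0 C0nW cut.
have [/existsP[x /existsP[y nxy]]|] := boolP [exists x, exists y, r x y != r2 x y];
  last first.
  move=> /existsPn h; apply: eq_promotion_conjugate => x y.
  by have /existsPn/(_ y) := h x; rewrite negbK => /eqP.
pose e u w := r u w != r2 u w.
have adjE u w : r u w || r w u = r2 u w || r2 w u by apply: adj.
have esym u w : e u w = e w u.
  rewrite /e; have := adjE u w.
  case ruw: (r u w); case rwu: (r w u); case r2uw: (r2 u w); case r2wu: (r2 w u) => //= _;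
    by [rewrite (strict_asym st ruw) in rwu | rewrite (strict_asym st2 r2uw) in r2wu].
have conn_sym : connect_sym e by apply: sym_connect_sym.
have eW u w : e u w -> u \in W /\ w \in W.
  move=> euw; split; apply: contraT => h; by rewrite /e out ?h ?orbT // eqxx in euw.
have xW : x \in W by have [] := eW _ _ nxy.
pose C := [set z | connect e x z].
have CW : C \subset W.
  apply/subsetP => z; rewrite inE; apply: connect_invariant => //.
  by move=> u w _ /eW[].
have e0 u w : e u w -> (u \in C0) = (w \in C0).
  move=> euw; have [uW wW] := eW _ _ euw.
  apply/idP/idP => h; apply: contraT => nh.
    by rewrite /e (cut u w) ?eqxx in euw.
  by move: euw; rewrite esym /e (cut w u) ?eqxx.
have C0E z : z \in C -> (z \in C0) = (x \in C0).
  rewrite inE => cxz; apply/eqP.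
  apply: (connect_invariant (a := fun z => (z \in C0) == (x \in C0))) cxz => //.
  by move=> u w _ /e0 <-.
have CnW : C \proper W.
  rewrite properE CW; apply/negP => WC.
  have [a aC0] := set0Pn _ C0n0.
  have /C0E E := subsetP WC a (subsetP C0W a aC0).
  case/negP: C0nW; rewrite eqEsubset C0W; apply/subsetP => z /(subsetP WC)/C0E->.
  by rewrite -E.
have outE z u : z \notin C -> u \in C -> r z u = r2 z u /\ r u z = r2 u z.
  rewrite !inE => ncz cu; split; apply/eqP; apply: contraNT ncz => euz.
    by apply: connect_trans cu (connect1 _); rewrite esym.
  by apply: connect_trans cu (connect1 _).
have modC : is_module r C.
  (* On an edge of disagreement one order has [u] below [w] and the other the reverse. Since both
     agree between [z] and [C], a relation of [z] to [u] passes to [w] by transitivity in one of the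
     two. *)
  have step z u w : z \notin C -> u \in C -> w \in C -> e u w ->
      (r z u -> r z w) * (r u z -> r w z).
    move=> zC uC wC euw; have [Eu1 Eu2] := outE z u zC uC.
    have [Ew1 Ew2] := outE z w zC wC; have [_ tr] := st; have [_ tr2] := st2.
    have cases : (r u w /\ r2 w u) \/ (r w u /\ r2 u w).
      move: euw (adjE u w) (esym u w); rewrite /e.
      by case: (r u w); case: (r w u); case: (r2 u w); case: (r2 w u) => //=; auto.
    case: cases => -[h1 h2]; split=> h.
    - exact: tr h h1.
    - by rewrite Ew2; apply: tr2 h2 _; rewrite -Eu2.
    - by rewrite Ew1; apply: tr2 h2; rewrite -Eu1.
    - exact: tr h1 h.
  have const z u : z \notin C -> u \in C -> r z x = r z u /\ r x z = r u z.
    move=> zC; have xC : x \in C by rewrite inE connect0.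
    rewrite inE => cxu.
    pose a u := (r z x == r z u) && (r x z == r u z).
    have : a u; last by case/andP=> /eqP-> /eqP->.
    apply: connect_invariant cxu; last by rewrite /a !eqxx.
    move=> v w cv evw /andP[/eqP E1 /eqP E2].
    have vC : v \in C by rewrite inE.
    have wC : w \in C by rewrite inE; apply: connect_trans cv (connect1 evw).
    have [s1 s2] := step z v w zC vC wC evw.
    have [s3 s4] := step z w v zC wC vC (etrans (esym w v) evw).
    rewrite /a E1 E2; apply/andP; split; apply/eqP; apply/idP/idP; auto.
  move=> z u w zC uC wC; have [E1 E2] := const z u zC uC.
  by have [E3 E4] := const z w zC wC; rewrite -E1 -E2 E3 E4.
apply: (promotion_conjugate_trans (IH (proper_card CnW) st st2 adj modC)).
have r1E u w : replace_module C r r2 u w != r2 u w -> r u w != r2 u w.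
  by rewrite /replace_module; case: ifP => //; rewrite eqxx.
apply: IHn => //.
- rewrite -ltnS; apply: leq_trans le_n; rewrite ltnS; apply: proper_card.
  apply/properP; split; first by apply/subsetP => p; rewrite !inE => /r1E.
  have yC : y \in C by rewrite inE connect1.
  by exists (x, y); rewrite !inE //= /replace_module inE connect0 yC eqxx.
- exact: replace_strict.
- by move=> u w; rewrite replace_adjacent.
- exact: replace_is_module.
- by move=> u w h; apply/eqP; apply: contraT => /r1E; rewrite out ?eqxx.
- move=> u w uC wW wC; apply/eqP; apply: contraT => /r1E.
  by rewrite cut ?eqxx.
Qed.

(** Let [C] be the incomparability component of an [r]-minimal [m] of [W]. An element of [W] outside
    [C] is comparable to all of [C] and cannot change side along incomparable pairs. So [r] puts [C]
    below the rest of [W], while [r2] puts some part [U1] below [C]. Then [C :|: U1] is a module of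
    [r2], and reversing it lifts [U1] above [C]: the orders now agree across [C]. *)
Lemma comparability_cut_conjugate C0 r r2 :
  strict_order r -> strict_order r2 -> adjacent r =2 adjacent r2 ->
  is_module r W -> agree_outside r r2 ->
  C0 \subset W -> C0 != set0 -> C0 != W ->
  (forall x y, x \in C0 -> y \in W -> y \notin C0 -> adjacent r x y) ->
  promotion_conjugate r r2.
Proof.
move=> st st2 adj modW out C0W C0n0 C0nW cut.
have adjC u w : adjacent r u w = adjacent r w u by rewrite /adjacent orbC.
have [a aC0] := set0Pn _ C0n0; have aW := subsetP C0W a aC0.
have [m mW m_min] : exists2 m, m \in W & forall z, z \in W -> r z m = false.
  case: (@arg_minnP _ a (mem W) (fun x => #|[set z in W | r z x]|) aW) => m mW min.
  exists m => // z zW; apply/negP => rzm; have := min z zW; rewrite leqNgt => /negP[].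
  have [irr tr] := st; apply: proper_card; apply/properP; split.
    by apply/subsetP => w; rewrite !inE => /andP[-> rwz]; apply: tr rwz rzm.
  by exists z; rewrite !inE zW ?irr.
pose e u w := [&& u \in W, w \in W & ~~ adjacent r u w].
have conn_sym : connect_sym e.
  by apply: sym_connect_sym => u w; rewrite /e adjC andbCA.
pose C := [set z | connect e m z].
have mC : m \in C by rewrite inE connect0.
have CW : C \subset W.
  apply/subsetP => z; rewrite inE; apply: connect_invariant => //.
  by move=> u w _ /and3P[].
have e0 u w : e u w -> (u \in C0) = (w \in C0).
  case/and3P=> uW wW nuw; apply/idP/idP => h; apply: contraNT nuw => nh.
    exact: cut.
  by rewrite adjC cut.
have C0E z : z \in C -> (z \in C0) = (m \in C0).
  rewrite inE => cmz; apply/eqP.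
  apply: (connect_invariant (a := fun z => (z \in C0) == (m \in C0))) cmz => //.
  by move=> u w _ /e0 <-.
have CnW : C != W.
  apply: contraNneq C0nW => WC; rewrite eqEsubset C0W; apply/subsetP => z.
  rewrite -WC => /C0E ->; rewrite -(C0E a) //; by rewrite WC.
have joined z u : z \in W -> z \notin C -> u \in C -> adjacent r u z.
  move=> zW nc uC; have uW := subsetP CW u uC; move: nc uC; rewrite !inE => nc cu.
  apply: contraNT nc => nuz; apply: connect_trans cu (connect1 _).
  by rewrite /e zW nuz uW.
have same_side (r' : rel T) z u : strict_order r' -> adjacent r' =2 adjacent r ->
    z \in W -> z \notin C -> u \in C -> r' m z -> r' u z.
  move=> [irr tr] adj' zW zC; rewrite inE => cu rmz.
  apply: (connect_invariant (a := r'^~ z)) cu => // v w cv evw rvz.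
  have wC : w \in C by rewrite inE; apply: connect_trans cv (connect1 evw).
  have := joined z w zW zC wC; rewrite -adj' => /orP[//|rzw].
  case/and3P: evw => _ _; rewrite -adj' /adjacent.
  by rewrite (tr _ _ _ rvz rzw).
have rC z u : z \in W -> z \notin C -> u \in C -> r u z.
  move=> zW zC uC; apply: (same_side r z u) => //.
  by have /orP[//|] := joined z m zW zC mC; rewrite m_min.
pose U1 := [set z in W :\: C | r2 z m].
have U1P z : z \in W -> z \notin C -> (z \in U1) = r2 z m.
  by move=> zW zC; rewrite !inE in zC *; rewrite zC zW.
have adj' : adjacent r2 =2 adjacent r by move=> u w; rewrite adj.
have below z u : z \in U1 -> u \in C -> r2 z u.
  rewrite inE => /andP[]; rewrite inE => /andP[zC zW] rzm uC.
  have := same_side (dual r2) z u; apply=> //; first exact: dual_strict.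
  by move=> v w; rewrite dual_adjacent adj'.
have above z u : z \in W -> z \notin C -> z \notin U1 -> u \in C -> r2 u z.
  move=> zW zC; rewrite U1P // => nz uC; apply: (same_side r2 z u) => //.
  by have := joined z m zW zC mC; rewrite -adj' /adjacent (negbTE nz) orbF.
pose N := C :|: U1.
have NW : N \subset W.
  by rewrite subUset CW; apply/subsetP => z; rewrite !inE => /andP[/andP[]].
have out2 x y : (x \notin W) || (y \notin W) -> r2 x y = r x y by move/out.
have modW2 : is_module r2 W.
  by move=> x y z xW yW zW; rewrite !out2 ?xW ?orbT //; apply: modW.
have modN : is_module r2 N.
  have aboveN z u : z \in W -> z \notin N -> u \in N -> r2 u z.
    move=> zW; rewrite !in_setU negb_or => /andP[zC zU] /orP[uC|uU].
      exact: above.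
    by have [_ tr2] := st2; apply: tr2 (below _ _ uU mC) (above _ _ zW zC zU mC).
  move=> x y z xN yN zN; have [xW|xW] := boolP (x \in W); last first.
    by apply: modW2 => //; apply: (subsetP NW).
  have ry := aboveN x y xW xN yN; have rz := aboveN x z xW xN zN.
  by rewrite (strict_asym st2 ry) (strict_asym st2 rz) ry rz.
have conj2 := reverse_module_conjugate modN.
apply: promotion_conjugate_trans (promotion_conjugate_sym conj2).
apply: (@disagreement_cut_conjugate C) => //.
- by apply: replace_strict => //; apply: dual_strict.
- move=> u w; rewrite (@replace_adjacent _ r2 (dual r2)) //.
  by move=> v t; rewrite dual_adjacent.
- move=> u w h; rewrite /reverse_module ifF ?out //; apply/negP => /andP[uN wN].
  by rewrite !(subsetP NW _) in h.
- by apply/set0Pn; exists m.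
- move=> x y xC yW yC; rewrite rC // /reverse_module in_setU xC /=.
  rewrite in_setU (negbTE yC) /=; case: ifP => [yU|/negbT yU].
    by rewrite below.
  by rewrite above.
Qed.

(** If agreement is the colour missing across the cut, every comparable pair across it is oriented
    oppositely, so reversing [r2] on all of [W] leads to the case where disagreement is missing. *)
Lemma module_replacement_step r r2 :
  strict_order r -> strict_order r2 -> adjacent r =2 adjacent r2 ->
  is_module r W -> agree_outside r r2 -> promotion_conjugate r r2.
Proof.
move=> st st2 adj modW out; have adjE u w : r u w || r w u = r2 u w || r2 w u := adj u w.
have [W1|W1] := leqP #|W| 1.
  apply: eq_promotion_conjugate => x y.
  have [xW|xW] := boolP (x \in W); last by rewrite out ?xW.
  have [yW|yW] := boolP (y \in W); last by rewrite out ?yW ?orbT.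
  have /card_le1_eqP/(_ _ _ xW yW) -> := W1.
  by have [irr _] := st; have [irr2 _] := st2; rewrite irr irr2.
pose col x y : 'I_3 :=
  inord (if adjacent r x y then (if r x y == r2 x y then 1 else 2) else 0).
have colE x y j : j < 3 -> (col x y == inord j) =
    ((if adjacent r x y then (if r x y == r2 x y then 1 else 2) else 0) == j).
  by move=> j3; rewrite -val_eqE /= !inordK //; do 2?case: ifP.
have asym u w : ~~ (r u w && r w u).
  by apply/negP => /andP[/(strict_asym st) ->].
have asym2 u w : ~~ (r2 u w && r2 w u).
  by apply/negP => /andP[/(strict_asym st2) ->].
have col_sym x y : col x y = col y x.
  rewrite /col /adjacent; congr inord; move: (adjE x y) (asym x y) (asym2 x y).
  by case: (r x y); case: (r y x); case: (r2 x y); case: (r2 y x).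
have [_ tr] := st; have [_ tr2] := st2.
have agreeE x y : col x y = inord 1 -> (r x y /\ r2 x y) \/ (r y x /\ r2 y x).
  move/eqP; rewrite colE // /adjacent; move: (adjE x y) (asym x y) (asym2 x y).
  by case: (r x y); case: (r y x); case: (r2 x y); case: (r2 y x) => //= *; auto.
have disagreeE x y : col x y = inord 2 -> (r x y /\ r2 y x) \/ (r y x /\ r2 x y).
  move/eqP; rewrite colE // /adjacent; move: (adjE x y) (asym x y) (asym2 x y).
  by case: (r x y); case: (r y x); case: (r2 x y); case: (r2 y x) => //= *; auto.
have incomparableE x y : col x y = inord 0 -> adjacent r x y = false.
  by move/eqP; rewrite colE //; case: ifP => //; case: ifP.
(* One of the two orders runs monotonically through [x], [y], [z], so transitivity makes [x] and [z]
   comparable. *)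
have triangle x y z : col x y = inord 1 -> col y z = inord 2 -> col x z <> inord 0.
  move=> /agreeE h1 /disagreeE h2 /incomparableE; have := adjE x z; rewrite /adjacent.
  case: h1 => -[h1 h1']; case: h2 => -[h2 h2'].
  - by rewrite (tr _ _ _ h1 h2).
  - by move=> -> ; rewrite (tr2 _ _ _ h1' h2').
  - by move=> ->; rewrite (tr2 _ _ _ h2' h1') orbT.
  - by rewrite (tr _ _ _ h2 h1) orbT.
have inordE (c : 'I_3) : [\/ c = inord 0, c = inord 1 | c = inord 2].
  rewrite -[c]inord_val; case: c => [[|[|[|//]]] /= _]; by [constructor 1 | constructor 2 | constructor 3].
have no_rainbow x y z : x != y -> y != z -> x != z ->
    [\/ col x y = col y z, col x z = col x y | col x z = col y z].
  move=> _ _ _; have t1 := triangle x y z; have t2 := triangle z y x.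
  have t3 := triangle y x z; have t4 := triangle z x y.
  have t5 := triangle x z y; have t6 := triangle y z x.
  move: t1 t2 t3 t4 t5 t6; rewrite (col_sym z y) (col_sym y x) (col_sym z x).
  case: (inordE (col x y)) => ->; case: (inordE (col y z)) => ->;
    case: (inordE (col x z)) => -> t1 t2 t3 t4 t5 t6;
    by [constructor 1 | constructor 2 | constructor 3
       | case: t1 | case: t2 | case: t3 | case: t4 | case: t5 | case: t6].
have [i [C /colour_cutP[CW C0 CnW cut]]] := gallai_cut col_sym no_rainbow W1.
case: (inordE i) cut => -> cut.
- apply: (comparability_cut_conjugate st st2 adj modW out CW C0 CnW) => x y xC yW yC.
  by have := cut x y xC yW yC; rewrite colE //; case: ifP.
- have modW2 : is_module r2 W.
    by move=> x y z xW yW zW; rewrite -!out ?xW ?orbT //; apply: modW.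
  apply: promotion_conjugate_trans (promotion_conjugate_sym (reverse_module_conjugate modW2)).
  apply: (@disagreement_cut_conjugate C) => //.
  + by apply: replace_strict => //; apply: dual_strict.
  + move=> u w; rewrite (@replace_adjacent _ r2 (dual r2)) //.
    by move=> v t; rewrite dual_adjacent.
  + by move=> u w h; rewrite /reverse_module ifF ?out //; apply/negbTE; rewrite negb_and.
  + move=> x y xC yW yC; have := cut x y xC yW yC; rewrite colE // /reverse_module.
    rewrite (subsetP CW x xC) yW /=.
    move: (adjE x y) (asym x y) (asym2 x y); rewrite /adjacent.
    by case: (r x y); case: (r y x); case: (r2 x y); case: (r2 y x).
- apply: (disagreement_cut_conjugate st st2 adj modW out CW C0 CnW) => x y xC yW yC.
  have := cut x y xC yW yC; rewrite colE // /adjacent.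
  move: (adjE x y) (asym x y) (asym2 x y).
  by case: (r x y); case: (r y x); case: (r2 x y); case: (r2 y x).
Qed.

End Step.

Theorem orientation_conjugate r r2 :
  strict_order r -> strict_order r2 -> adjacent r =2 adjacent r2 ->
  promotion_conjugate r r2.
Proof.
move=> st st2 adj.
have modT r' : is_module r' setT by move=> x y z; rewrite inE.
have main W : forall r r2, strict_order r -> strict_order r2 ->
    adjacent r =2 adjacent r2 -> is_module r W ->
    promotion_conjugate r (replace_module W r r2).
  have [n] := ubnP #|W|; elim: n W => // n IHn W le_n r' r2' st' st2' adj' modW.
  apply: (@module_replacement_step W) => //.
  - by move=> C r3 r4 ltC; apply: IHn; apply: leq_trans ltC _; rewrite -ltnS.
  - exact: replace_strict.
  - by move=> u w; rewrite replace_adjacent.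
  - by move=> u w h; rewrite /replace_module ifF //; apply/negbTE; rewrite negb_and.
apply: promotion_conjugate_trans (main setT _ _ st st2 adj (modT r)) _.
by apply: eq_promotion_conjugate => x y; rewrite /replace_module !inE.
Qed.

End Orientations.

Import Order.TTheory.

(** * From rowmotion to promotion *)

Section RowmotionRecursion.
Variables (d : Order.disp_t) (Q : finPOrderType d).
Implicit Types (I : ideal Q) (x y z : Q).

Lemma ideal_down I x y : x \in (I : {set Q}) -> (y <= x)%O -> y \in (I : {set Q}).
Proof.
move=> xI yx; have /forall_inP/(_ x xI)/forallP/(_ y)/implyP := ideal_setP I.
exact.
Qed.

Lemma mem_rowmotion I x : (x \in (rowmotion I : {set Q})) =
  [exists y, [&& y \notin (I : {set Q}),
     [forall z, (z < y)%O ==> (z \in (I : {set Q}))] & (x <= y)%O]].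
Proof.
rewrite inE; apply: eq_existsb => y; rewrite !inE -andbA; congr (_ && (_ && _)).
rewrite negb_exists; apply: eq_forallb => z.
by rewrite inE negb_and negbK; case: (z < y)%O; rewrite /= ?orbT ?orbF.
Qed.

(** This and the two lemmas that follow are the local rules through which rowmotion enters the
    height estimates. *)
Lemma rowmotion_lower I x z :
  x \in (rowmotion I : {set Q}) -> (z < x)%O -> z \in (I : {set Q}).
Proof.
rewrite mem_rowmotion => /existsP[y /and3P[_ /forallP h xy]] zx.
by have := h z; rewrite (lt_le_trans zx xy).
Qed.

Lemma rowmotion_in I x : x \in (I : {set Q}) -> x \in (rowmotion I : {set Q}) ->
  exists2 y, (x < y)%O & y \in (rowmotion I : {set Q}).
Proof.
move=> xI; rewrite mem_rowmotion => /existsP[y /and3P[yI h xy]]; exists y.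
  by rewrite lt_neqAle xy andbT; apply: contraNneq yI => <-.
by rewrite mem_rowmotion; apply/existsP; exists y; rewrite yI h lexx.
Qed.

Lemma rowmotion_out I x : x \notin (I : {set Q}) ->
  (forall z, (z < x)%O -> z \in (I : {set Q})) -> x \in (rowmotion I : {set Q}).
Proof.
move=> xI h; rewrite mem_rowmotion; apply/existsP; exists x; rewrite xI lexx andbT.
by apply/forallP => z; apply/implyP; apply: h.
Qed.

End RowmotionRecursion.

Section ProductWithChain.
Variables (d : Order.disp_t) (P : finPOrderType d) (c : nat).
Local Notation Pc := (P *p 'I_c).
Implicit Types (I : ideal Pc) (p : P) (j : nat).

(** Levels are natural numbers, empty from [c] on, so that neighbouring levels can be named without
    bounds. *)
Definition mem_level I p j : bool :=
  if insub j is Some i then ((p, i) : Pc) \in (I : {set Pc}) else false.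

Lemma mem_levelE I p (i : 'I_c) :
  mem_level I p i = (((p, i) : Pc) \in (I : {set Pc})).
Proof. by rewrite /mem_level valK. Qed.

Lemma mem_level_lt I p j : mem_level I p j -> j < c.
Proof. by rewrite /mem_level; case: insubP. Qed.

Lemma level_ord j : j < c -> exists i : 'I_c, j = i.
Proof. by move=> ltj; exists (Ordinal ltj). Qed.

Lemma le_pair p p' (i i' : 'I_c) :
  (((p, i) : Pc) <= ((p', i') : Pc))%O = (p <= p')%O && (i <= i').
Proof. by rewrite leEprod /= leEord. Qed.

Lemma mem_level_down I p p' j j' :
  mem_level I p j -> (p' <= p)%O -> j' <= j -> mem_level I p' j'.
Proof.
move=> h; have := mem_level_lt h => ltj p'p j'j; move: h.
have [i Ei] := level_ord ltj; have [i' Ei'] := level_ord (leq_ltn_trans j'j ltj).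
by subst; rewrite !mem_levelE => /ideal_down; apply; rewrite le_pair p'p.
Qed.

Lemma mem_level_lower I p p' j j' : mem_level (rowmotion I) p j ->
  (p' <= p)%O -> j' <= j -> (p' != p) || (j' != j) -> mem_level I p' j'.
Proof.
move=> h; have := mem_level_lt h => ltj p'p j'j; move: h.
have [i Ei] := level_ord ltj; have [i' Ei'] := level_ord (leq_ltn_trans j'j ltj).
subst; rewrite !mem_levelE => h ne; apply: (rowmotion_lower h).
rewrite lt_neqAle le_pair p'p j'j xpair_eqE negb_and.
by rewrite !andbT; exact: ne.
Qed.

Lemma mem_level_in I p j : mem_level I p j -> mem_level (rowmotion I) p j ->
  (exists2 p', (p < p')%O & mem_level (rowmotion I) p' j) \/
  mem_level (rowmotion I) p j.+1.
Proof.
move=> h; have [i Ei] := level_ord (mem_level_lt h); subst j; move: h.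
rewrite !mem_levelE => h /(rowmotion_in h)[[p' i'] lt_pp' h'].
have /andP[pp' ii'] : (p <= p')%O && (i <= i') by rewrite -le_pair ltW.
have {}h' : mem_level (rowmotion I) p' i' by rewrite mem_levelE.
have [Ep|ne] := eqVneq p p'; last first.
  left; exists p'; first by rewrite lt_neqAle ne.
  exact: mem_level_down h' _ _.
right; rewrite Ep; apply: mem_level_down h' _ _ => //.
rewrite ltn_neqAle ii' andbT; apply: contraTneq lt_pp' => Ei.
by rewrite Ep (_ : i = i') ?ltxx //; apply: val_inj.
Qed.

Lemma mem_level_out I p j : j < c -> ~~ mem_level I p j ->
  (forall z, (z < p)%O -> mem_level I z j) -> (0 < j -> mem_level I p j.-1) ->
  mem_level (rowmotion I) p j.
Proof.
move=> ltj; have [i Ei] := level_ord ltj; subst j.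
rewrite !mem_levelE => h hz hj; apply: rowmotion_out => // -[p' i'] lt_p'p.
have /andP[p'p i'i] : (p' <= p)%O && (i' <= i) by rewrite -le_pair ltW.
rewrite -mem_levelE; have [Ep|ne] := eqVneq p' p; last first.
  by apply: mem_level_down (hz p' _) _ _; rewrite ?lt_neqAle ?ne.
have lt_i : i' < i.
  rewrite ltn_neqAle i'i andbT; apply: contraTneq lt_p'p => Ei.
  by rewrite Ep (_ : i' = i) ?ltxx //; apply: val_inj.
by rewrite Ep; apply: mem_level_down (hj _) _ _ => //; lia.
Qed.

Lemma ideal_eq I I' : (forall p j, mem_level I p j = mem_level I' p j) -> I = I'.
Proof.
by move=> E; apply/val_inj/setP => -[p i]; rewrite -!mem_levelE E.
Qed.

End ProductWithChain.

(** The form in which gradedness is used: minimal elements have rank 0, maximal ones rank [N - 1],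
    and a strict relation can be refined by a rank step of one at either end. *)
Record is_rank (d : Order.disp_t) (P : finPOrderType d) (rk : P -> nat) (N : nat) : Prop :=
  IsRank {
    rank_lt : forall x, rk x < N;
    rank_mono : forall x y, (x < y)%O -> rk x < rk y;
    rank_up : forall x y, (x < y)%O ->
      exists z, [/\ (x < z)%O, (z <= y)%O & rk z = (rk x).+1];
    rank_down : forall x y, (x < y)%O ->
      exists z, [/\ (x <= z)%O, (z < y)%O & rk y = (rk z).+1];
    rank_bottom : forall x, 0 < rk x -> exists z, (z < x)%O;
    rank_top : forall x, (rk x).+1 < N -> exists y, (x < y)%O }.

Lemma lt_strict (d : Order.disp_t) (P : porderType d) : strict_order (<%O : rel P).
Proof. by split; [exact: ltxx | exact: lt_trans]. Qed.

(** * The diagonal reading of a rowmotion orbit *)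

Section RowmotionPromotion.
Variables (d : Order.disp_t) (P : finPOrderType d) (c N : nat) (rk : P -> nat).
Hypothesis rkP : is_rank rk N.
Local Notation Pc := (P *p 'I_c).
Local Notation lt := (<%O : rel P).
Local Notation q := (N + c).
Implicit Types (I : ideal Pc) (p x y z : P) (j : nat) (f : {ffun P -> nat}).

(* Level j is read j steps later along the orbit. *)
Definition diagonal I p j : bool := mem_level (iter j (@rowmotion _ Pc) I) p j.

(** By [diagonal_pred] the levels present form an initial segment, so the first missing one
    describes them; [find] gives [c] when none is missing. *)
Definition diagonal_height I p : nat := find (fun j => ~~ diagonal I p j) (iota 0 c).

Lemma diagonal_pred I p j : diagonal I p j.+1 -> diagonal I p j.
Proof.
rewrite /diagonal iterS => h; apply: mem_level_lower h _ _ _ => //.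
by rewrite orbC neq_ltn ltnSn.
Qed.

Lemma diagonal_height_le I p : diagonal_height I p <= c.
Proof. by rewrite -[leqRHS](size_iota 0 c) find_size. Qed.

Lemma diagonalE I p j : diagonal I p j = (j < diagonal_height I p).
Proof.
have [lt_j|le_j] := ltnP j (diagonal_height I p).
  have := before_find 0 lt_j; rewrite nth_iota ?add0n => [/negbFE //|].
  exact: leq_trans lt_j (diagonal_height_le I p).
apply/negbTE; have [lt_c|le_c] := ltnP (diagonal_height I p) c; last first.
  by apply/negP => /mem_level_lt; move: le_j le_c; lia.
have nh : ~~ diagonal I p (diagonal_height I p).
  rewrite -[X in diagonal _ _ X](_ : nth 0 (iota 0 c) (diagonal_height I p) = _).
    by apply: (@nth_find _ 0 (fun j => ~~ diagonal I p j)); rewrite has_find size_iota.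
  by rewrite nth_iota.
rewrite -(subnKC le_j); elim: (j - _) => [|i IHi]; first by rewrite addn0.
by rewrite addnS; apply: contra IHi; apply: diagonal_pred.
Qed.

Lemma diagonal_rowmotion I p j :
  diagonal (rowmotion I) p j = mem_level (rowmotion (iter j (@rowmotion _ Pc) I)) p j.
Proof. by rewrite /diagonal -iterSr. Qed.

Local Notation h0 I := (diagonal_height I).
Local Notation h1 I := (diagonal_height (rowmotion I)).

Lemma height_anti I p x : (p <= x)%O -> h0 I x <= h0 I p.
Proof.
move=> px; rewrite leqNgt; apply/negP; rewrite -diagonalE => h.
suff : diagonal I p (h0 I p) by rewrite diagonalE ltnn.
exact: mem_level_down h px _.
Qed.

Lemma height_next_le I p x : (p < x)%O -> h1 I x <= h0 I p.
Proof.
move=> px; rewrite leqNgt; apply/negP; rewrite -diagonalE diagonal_rowmotion => h.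
suff : diagonal I p (h0 I p) by rewrite diagonalE ltnn.
by apply: mem_level_lower h (ltW px) _ _; rewrite ?(lt_eqF px).
Qed.

Lemma height_next_ge I p : (h0 I p).-1 <= h1 I p.
Proof.
case E : (h0 I p) => [//|[//|n]]; rewrite /= -diagonalE diagonal_rowmotion.
have : diagonal I p n.+1 by rewrite diagonalE E.
by rewrite /diagonal iterS => h; apply: mem_level_down h _ _.
Qed.

(** A level that survives rowmotion lies below another element of the new ideal. The next level of
    the same column is excluded by the height, so a column above [p] supplies it. *)
Lemma height_stay I p : 0 < h0 I p -> h0 I p <= h1 I p ->
  exists2 x, (p < x)%O & h0 I p <= h1 I x.
Proof.
case E : (h0 I p) => [//|n] _; rewrite -diagonalE diagonal_rowmotion => h.
have := mem_level_in (_ : mem_level (iter n (@rowmotion _ Pc) I) p n) h.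
case=> [|[x px hx]|hn]; first by rewrite -/(diagonal I p n) diagonalE E.
  by exists x => //; rewrite -diagonalE diagonal_rowmotion.
by move: hn; rewrite -iterS -/(diagonal I p n.+1) diagonalE E ltnn.
Qed.

Lemma height_raise I p j : j < c -> h0 I p <= j -> j <= h1 I p ->
  (forall z, (z < p)%O -> j < h0 I z) -> j < h1 I p.
Proof.
move=> ltj h0j jh1 hz; rewrite -diagonalE diagonal_rowmotion.
apply: mem_level_out => // [|z /hz|].
- by rewrite -/(diagonal I p j) diagonalE -leqNgt.
- by rewrite -diagonalE.
- case: j jh1 {ltj h0j hz} => // j; rewrite -diagonalE diagonal_rowmotion.
  by rewrite iterS.
Qed.

(** Heights decrease weakly along [P] and lie between 0 and [c]; the rank makes the labels strictly
    increasing, with values from [rk p] to [rk p + c], which explains the bound [N + c]. *)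
Definition ideal_label I : {ffun P -> nat} := [ffun p => rk p + c - diagonal_height I p].

Lemma ideal_label_labeling I : labeling lt q (ideal_label I).
Proof.
apply/labelingP; split=> [p|p x px]; rewrite !ffunE.
  by have := rank_lt rkP p; lia.
have := rank_mono rkP px; have := height_anti I (ltW px).
by have := diagonal_height_le I p; lia.
Qed.

Lemma ideal_label_rowmotion I :
  ideal_label (rowmotion I) = promotion lt q (ideal_label I).
Proof.
apply: promotion_unique; first exact: ideal_label_labeling.
move=> p; set f := ideal_label I.
have fE x : f x = rk x + c - h0 I x by rewrite ffunE.
have f'E x : ideal_label (rowmotion I) x = rk x + c - h1 I x by rewrite ffunE.
move: (ideal_label (rowmotion I)) f f'E fE => f' f f'E fE.
have le0 x : h0 I x <= c by apply: diagonal_height_le.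
have le1 x : h1 I x <= c by apply: diagonal_height_le.
(* The elements that do not slide are those whose diagonal height drops, and it drops by exactly
   one. *)
have [stay|leave] := leqP (h0 I p) (h1 I p); last first.
  rewrite ifT; first by rewrite f'E fE; have := height_next_ge I p; have := le0 p; lia.
  have p_lt := rank_lt rkP p.
  apply/andP; split; first by rewrite fE; have := le0 p; lia.
  apply/forallP => y; apply/implyP => py; apply/eqP; rewrite f'E fE => E.
  have rk_py := rank_mono rkP py; have h1py := height_anti (rowmotion I) (ltW py).
  by have := le0 p; have := le1 y; lia.
rewrite ifF; last first.
  apply/negP => /andP[fq /forallP no_up].
  (* The blocking element has rank one more than [p] and next height equal to the present height of
     [p]. *)
  suff [y py Ey] : exists2 y, (p < y)%O & f' y = (f p).+1.
    by have := no_up y; rewrite py Ey eqxx.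
  have [h0p|h0p] := posnP (h0 I p).
    have [y py] : exists y, (p < y)%O.
      by apply: (rank_top rkP); move: fq; rewrite fE h0p; lia.
    have [z [pz _ rkz]] := rank_up rkP py; exists z => //.
    by have := height_next_le I pz; rewrite f'E fE h0p rkz; lia.
  have [y py h1y] := height_stay h0p stay.
  have [z [pz zy rkz]] := rank_up rkP py; exists z => //.
  have := height_next_le I pz; have := height_anti (rowmotion I) zy.
  by rewrite f'E fE rkz; have := le0 p; lia.
rewrite f'E; apply/eqP; rewrite eqn_leq; apply/andP; split; last first.
  apply: floor_label_le => z zp; rewrite fE.
  have := rank_mono rkP zp; have := height_next_le I zp; have := le0 z.
  by lia.
(* Any [z] of small enough height will do: an element of rank one less than [p] and above [z] is no
   higher, and its label reaches the floor. *)
have floor_ge z : (z < p)%O -> h0 I z <= h1 I p ->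
    rk p + c - h1 I p <= floor_label lt f p.
  move=> zp h0z; have [y [zy yp rky]] := rank_down rkP zp.
  have := floor_label_ge f (yp : lt y p); rewrite fE rky.
  by have := height_anti I zy; lia.
have := le1 p; rewrite leq_eqVlt => /predU1P[h1c|h1c].
  rewrite h1c addnK; have [->//|rk_gt0] := posnP (rk p).
  have [z zp] := rank_bottom rkP rk_gt0.
  by rewrite -[rk p](addnK c) -{2}h1c; apply: (floor_ge z zp); rewrite h1c.
have [/existsP[z /andP[zp h0z]]|none] := boolP [exists z, (z < p)%O && (h0 I z <= h1 I p)].
  exact: floor_ge zp h0z.
(* With no such [z], [height_raise] at level [h1 I p] would add that level to the new ideal. *)
suff : h1 I p < h1 I p by rewrite ltnn.
apply: height_raise => // z zp; rewrite ltnNge; apply: contra none => h0z.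
by apply/existsP; exists z; rewrite zp.
Qed.

(** Equal labels stay equal under promotion, so the diagonals agree at all later times. Level [j] of
    the [c]-th iterate lies on the diagonal started at time [c - j]; thus the [c]-th iterates
    coincide, and rowmotion is injective. *)
Lemma ideal_label_inj : injective ideal_label.
Proof.
move=> I I' E; have heightE J J' : ideal_label J = ideal_label J' ->
    diagonal_height J =1 diagonal_height J'.
  move=> /ffunP EJ p; have := EJ p; rewrite !ffunE.
  by have := diagonal_height_le J p; have := diagonal_height_le J' p; lia.
have Et t : ideal_label (iter t (@rowmotion _ Pc) I) =
            ideal_label (iter t (@rowmotion _ Pc) I').
  by elim: t => //= t; rewrite !ideal_label_rowmotion => ->.
have iter_inj n : injective (iter n (@rowmotion _ Pc)).
  by elim: n => [|n IHn] J J' //= /rowmotion_inj/IHn.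
apply: (iter_inj c); apply: ideal_eq => p j; have [ltj|lej] := ltnP j c; last first.
  by rewrite /mem_level insubN // -leqNgt.
have splitE J : iter c (@rowmotion _ Pc) J =
    iter j (@rowmotion _ Pc) (iter (c - j) (@rowmotion _ Pc) J).
  by rewrite -iterD subnKC // ltnW.
by rewrite !splitE -!/(diagonal _ p j) !diagonalE (heightE _ _ (Et (c - j))).
Qed.

Lemma label_gap f x y : labeling lt q f -> (x <= y)%O -> f x + rk y <= f y + rk x.
Proof.
move=> /labelingP[_ inc']; have inc u v : (u < v)%O -> f u < f v := inc' u v.
have [n] := ubnP (rk y - rk x).
elim: n x => // n IHn x le_n; rewrite le_eqVlt => /predU1P[->//|xy].
have [z [xz zy rkz]] := rank_up rkP xy.
have lt_xy := rank_mono rkP xy; have := inc _ _ xz.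
have lt_n : rk y - rk z < n by lia.
by have := IHn z lt_n zy; lia.
Qed.

Lemma rank_le_label f x : labeling lt q f -> rk x <= f x.
Proof.
move=> lab; have /labelingP[_ inc'] := lab.
have inc u v : (u < v)%O -> f u < f v := inc' u v.
have [n] := ubnP (rk x); elim: n x => // n IHn x le_n.
have [->//|/(rank_bottom rkP)[y yx]] := posnP (rk x).
have [z [_ zx rkz]] := rank_down rkP yx.
have lt_n : rk z < n by lia.
by have := IHn z lt_n; have := inc _ _ zx; lia.
Qed.

Lemma label_le_rank f x : labeling lt q f -> f x <= rk x + c.
Proof.
move=> lab; have /labelingP[lt_q' inc'] := lab.
have inc u v : (u < v)%O -> f u < f v := inc' u v; have lt_q u : f u < q := lt_q' u.
have [n] := ubnP (N - rk x); elim: n x => // n IHn x le_n.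
have rkx := rank_lt rkP x; have := lt_q x.
have [top|/(rank_top rkP)[y xy]] := leqP N (rk x).+1; first by lia.
have [z [xz _ rkz]] := rank_up rkP xy.
have lt_n : N - rk z < n by lia.
by have := IHn z lt_n; have := inc _ _ xz; lia.
Qed.

(** The straight reading, without time shift: column [p] has height [rk p + c - f p]. Its
    injectivity serves to compare cardinalities. *)
Definition label_ideal f : ideal Pc :=
  Ideal (down_closure_ideal [set x : Pc | x.2 + f x.1 < rk x.1 + c]).

Lemma mem_label_ideal f p (i : 'I_c) : labeling lt q f ->
  (((p, i) : Pc) \in (label_ideal f : {set Pc})) = (i + f p < rk p + c).
Proof.
move=> lab; rewrite inE; apply/exists_inP/idP => [[[x j]]|h].
  rewrite inE /= le_pair => h /andP[px ij].
  by have := label_gap lab px; lia.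
by exists (p, i); rewrite ?inE.
Qed.

Lemma label_ideal_inj f f' : labeling lt q f -> labeling lt q f' ->
  label_ideal f = label_ideal f' -> f = f'.
Proof.
move=> lab lab' E; apply/ffunP => p.
have hE j : j < c -> (j + f p < rk p + c) = (j + f' p < rk p + c).
  by move=> ltj; rewrite -!(mem_label_ideal p (Ordinal ltj)) // E.
have := rank_le_label p lab; have := rank_le_label p lab'.
have := label_le_rank p lab; have := label_le_rank p lab'.
move=> le' le ge' ge; case: (ltngtP (f p) (f' p)) => // lt_ff.
  have ltj : rk p + c - f' p < c by lia.
  by have := hE _ ltj; lia.
have ltj : rk p + c - f p < c by lia.
by have := hE _ ltj; lia.
Qed.

(** The composite of the two injections is a self-map of a finite type, hence bijective. This makes
    [ideal_label] onto and yields its inverse without rebuilding an ideal from its diagonals. *)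
Theorem rowmotion_promotion_conjugate :
  conjugate predT (@rowmotion _ Pc) (labeling lt q) (promotion lt q).
Proof.
have inj : injective (label_ideal \o ideal_label).
  by move=> I I' /label_ideal_inj E; apply/ideal_label_inj/E; apply: ideal_label_labeling.
have bij : bijective (label_ideal \o ideal_label) := injF_bij inj.
have [g gK Kg] := bij; split=> //.
exists ideal_label, (g \o label_ideal); split=> [I _|f lab] /=.
  split; [exact: ideal_label_labeling | exact: gK | exact: ideal_label_rowmotion].
split=> //; apply: label_ideal_inj => //; first exact: ideal_label_labeling.
exact: (Kg (label_ideal f)).
Qed.

End RowmotionPromotion.

(** * The rank function of a graded poset *)

Section GradedRank.
Variables (d : Order.disp_t) (P : finPOrderType d).
Implicit Types (C D E : {set P}) (x y z : P).

Lemma is_chainP C :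
  reflect {in C &, forall x y, (x >=< y)%O} (is_chain C).
Proof.
apply: (iffP forall_inP) => h x; last by move=> xC; apply/forall_inP => y; apply: h.
by move=> y xC yC; have /forall_inP/(_ y yC) := h x xC.
Qed.

Lemma is_chain0 : is_chain (set0 : {set P}).
Proof. by apply/is_chainP => x y; rewrite inE. Qed.

Lemma is_chainU C D : is_chain C -> is_chain D ->
  (forall x y, x \in C -> y \in D -> (x >=< y)%O) -> is_chain (C :|: D).
Proof.
move=> /is_chainP hC /is_chainP hD h; apply/is_chainP => x y.
rewrite !inE => /orP[xC|xD] /orP[yC|yD]; [exact: hC | exact: h | | exact: hD].
by rewrite comparable_sym; apply: h.
Qed.

Lemma is_chain1 x : is_chain [set x].
Proof. by apply/is_chainP => y z; rewrite !inE => /eqP-> /eqP->; apply: comparablexx. Qed.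

Definition max_chain_card : nat := \max_(C : {set P} | is_chain C) #|C|.

Definition longest_chain_in (A : {set P}) : nat :=
  \max_(C : {set P} | is_chain C && (C \subset A)) #|C|.

Lemma longest_chain_in_attained (A : {set P}) :
  exists C, [/\ is_chain C, C \subset A & #|C| = longest_chain_in A].
Proof.
have [|C /andP[hC CA] E] :=
  @eq_bigmax_cond _ (fun C => is_chain C && (C \subset A)) (fun C => #|C|).
  by apply/card_gt0P; exists set0; rewrite /in_mem /= is_chain0 sub0set.
by exists C.
Qed.

Lemma longest_chain_in_ge (A C : {set P}) :
  is_chain C -> C \subset A -> #|C| <= longest_chain_in A.
Proof.
move=> hC CA; apply: (@leq_bigmax_cond _ (fun C => is_chain C && (C \subset A))).
by rewrite hC.
Qed.

Definition below x := [set z | (z < x)%O].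
Definition above x := [set z | (x < z)%O].

Hypothesis gradedP : graded P.

Lemma maxset_chain_card E : maxset is_chain E -> #|E| = max_chain_card.
Proof.
move=> maxE; have [|M hM EM] := @eq_bigmax_cond _ (@is_chain _ P) (fun C => #|C|).
  by apply/card_gt0P; exists set0; exact: is_chain0.
have maxM : maxset is_chain M.
  apply/maxsetP; split=> // B hB MB; apply/eqP; rewrite eq_sym eqEcard MB -EM.
  exact: (@leq_bigmax_cond _ _ (fun C : {set P} => #|C|)).
have := gradedP maxE maxM; rewrite /chain_length /max_chain_card EM.
by move=> /GRing.addIr[].
Qed.

(** Longest chains below [x] and above [y], joined by [x] and [y], form a maximal chain;
    [(x != y).+1] is the size of [[set x; y]]. The case [x = y] gives [height_split], and comparing
    it with a cover gives [height_cover]. *)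
Lemma chain_through x y :
  (x <= y)%O -> (forall z, (x < z)%O -> (z < y)%O -> false) ->
  longest_chain_in (below x) + (x != y).+1 + longest_chain_in (above y) =
  max_chain_card.
Proof.
move=> xy cover.
have [C [hC Cx EC]] := longest_chain_in_attained (below x).
have [D [hD Dy ED]] := longest_chain_in_attained (above y).
have ltC z : z \in C -> (z < x)%O by move/(subsetP Cx); rewrite inE.
have ltD z : z \in D -> (y < z)%O by move/(subsetP Dy); rewrite inE.
have maxE : maxset is_chain (C :|: [set x; y] :|: D).
  apply/maxsetP; split.
    apply: is_chainU => //; first apply: is_chainU => //.
    - apply/is_chainP => u v; rewrite !inE => /orP[]/eqP-> /orP[]/eqP->;
        by rewrite /Order.comparable ?lexx ?xy ?orbT.
    - move=> u v /ltC ux; rewrite !inE /Order.comparable => /orP[]/eqP->; first by rewrite ltW.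
      by rewrite (le_trans (ltW ux) xy).
    - move=> u v; rewrite !inE /Order.comparable => /orP[/ltC ux|uxy] /ltD yv.
        by rewrite (le_trans (ltW ux) (le_trans xy (ltW yv))).
      by case/orP: uxy => /eqP->; rewrite ?(le_trans xy (ltW yv)) ?(ltW yv).
  move=> B /is_chainP hB; rewrite !subUset !sub1set => /andP[/andP[CB /andP[xB yB]] DB].
  apply/eqP; rewrite eqEsubset; apply/andP; split; last first.
    by rewrite !subUset !sub1set CB xB yB DB.
  apply/subsetP => w wB; rewrite !inE.
  have [wC|wC] /= := boolP (w \in C); first by [].
  have [wD|wD] /= := boolP (w \in D); first by rewrite orbT.
  rewrite orbF.
  have [//|wx] := eqVneq w x; have [//|wy] /= := eqVneq w y.
  have xw : (x < w)%O.
    have /orP[h|h] := hB x w xB wB; first by rewrite lt_neqAle eq_sym wx h.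
    have wltx : (w < x)%O by rewrite lt_neqAle wx h.
    have hwC : is_chain (w |: C).
      apply: is_chainU => //; first exact: is_chain1.
      by move=> u v; rewrite inE => /eqP-> vC; apply: hB => //; apply: (subsetP CB).
    have wCx : w |: C \subset below x by rewrite subUset sub1set inE wltx.
    by have := longest_chain_in_ge hwC wCx; rewrite -EC cardsU1 wC ltnn.
  have /orP[h|h] := hB w y wB yB.
    by apply: (cover w) => //; rewrite lt_neqAle wy h.
  have yltw : (y < w)%O by rewrite lt_neqAle eq_sym wy h.
  have hwD : is_chain (w |: D).
    apply: is_chainU => //; first exact: is_chain1.
    by move=> u v; rewrite inE => /eqP-> vD; apply: hB => //; apply: (subsetP DB).
  have wDy : w |: D \subset above y by rewrite subUset sub1set inE yltw.
  by have := longest_chain_in_ge hwD wDy; rewrite -ED cardsU1 wD ltnn.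
rewrite -(maxset_chain_card maxE) -EC -ED cardsU disjoint_setI0; last first.
  rewrite disjoints_subset; apply/subsetP => u; rewrite !inE => /orP[/ltC ux|uxy].
    apply/negP => /ltD yu; by have := lt_trans (lt_le_trans ux xy) yu; rewrite ltxx.
  apply/negP => /ltD yu; case/orP: uxy yu => /eqP->; last by rewrite ltxx.
  by move=> yx; have := lt_le_trans yx xy; rewrite ltxx.
rewrite cards0 subn0 cardsU disjoint_setI0 ?cards0 ?subn0 ?cards2 //.
rewrite disjoints_subset; apply/subsetP => u /ltC ux; rewrite !inE negb_or.
by rewrite (lt_eqF ux) (lt_eqF (lt_le_trans ux xy)).
Qed.

Definition height_below x : nat := longest_chain_in (below x).

Lemma height_split x :
  height_below x + longest_chain_in (above x) + 1 = max_chain_card.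
Proof.
have := @chain_through x x (lexx x); rewrite eqxx /height_below => <-; first by lia.
by move=> z xz zx; have := lt_trans xz zx; rewrite ltxx.
Qed.

Lemma height_cover x y : (x < y)%O -> (forall z, (x < z)%O -> (z < y)%O -> false) ->
  height_below y = (height_below x).+1.
Proof.
move=> xy cover; have := chain_through (ltW xy) cover; have := height_split y.
by rewrite (lt_eqF xy) /height_below /=; lia.
Qed.

Lemma longest_chain_in_set0 (A : {set P}) :
  0 < longest_chain_in A -> exists x, x \in A.
Proof.
have [C [_ CA <-]] := longest_chain_in_attained A.
by rewrite card_gt0 => /set0Pn[x xC]; exists x; apply: (subsetP CA).
Qed.

Lemma upper_cover x y : (x < y)%O -> exists z, [/\ (x < z)%O, (z <= y)%O
  & forall w, (x < w)%O -> (w < z)%O -> false].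
Proof.
move=> xy; pose a z := (x < z)%O && (z <= y)%O.
have ay : a y by rewrite /a xy lexx.
case: (@arg_minnP _ y a (fun z => #|below z|) ay) => z /andP[xz zy] min.
exists z; split=> // w xw wz; have := min w; rewrite /a xw (le_trans (ltW wz) zy).
move=> /(_ isT); rewrite leqNgt => /negP[]; apply: proper_card; apply/properP; split.
  by apply/subsetP => u; rewrite !inE => /lt_trans; apply.
by exists w; rewrite !inE ?ltxx.
Qed.

Lemma lower_cover x y : (x < y)%O -> exists z, [/\ (x <= z)%O, (z < y)%O
  & forall w, (z < w)%O -> (w < y)%O -> false].
Proof.
move=> xy; pose a z := (x <= z)%O && (z < y)%O.
have ax : a x by rewrite /a xy lexx.
case: (@arg_minnP _ x a (fun z => #|above z|) ax) => z /andP[xz zy] min.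
exists z; split=> // w zw wy; have := min w; rewrite /a wy (le_trans xz (ltW zw)).
move=> /(_ isT); rewrite leqNgt => /negP[]; apply: proper_card; apply/properP; split.
  by apply/subsetP => u; rewrite !inE; apply: lt_trans.
by exists w; rewrite !inE ?ltxx.
Qed.

Lemma graded_is_rank : is_rank height_below max_chain_card.
Proof.
split.
- by move=> x; rewrite -(height_split x); lia.
- move=> x y xy; have [C [hC Cx EC]] := longest_chain_in_attained (below x).
  have ltC z : z \in C -> (z < x)%O by move/(subsetP Cx); rewrite inE.
  rewrite /height_below -EC; have xC : x \notin C.
    by apply/negP => /ltC; rewrite ltxx.
  have -> : #|C|.+1 = #|x |: C| by rewrite cardsU1 xC.
  apply: longest_chain_in_ge.
    apply: is_chainU => //; first exact: is_chain1.
    by move=> u v; rewrite inE => /eqP-> /ltC /ltW; rewrite /Order.comparable orbC => ->.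
  apply/subsetP => u; rewrite !inE => /orP[/eqP->//|/ltC ux].
  exact: lt_trans ux xy.
- by move=> x y /upper_cover[z [xz zy cover]]; exists z; split; rewrite // (height_cover xz).
- by move=> x y /lower_cover[z [xz zy cover]]; exists z; split; rewrite // (height_cover zy).
- by move=> x /longest_chain_in_set0[z]; rewrite inE; exists z.
- move=> x lt_x; have [|y] := @longest_chain_in_set0 (above x).
    by have := height_split x; move: lt_x; rewrite /height_below; lia.
  by rewrite inE; exists y.
Qed.

End GradedRank.

(** * Comparability invariance *)

Section ComparabilityInvariance.
Variables (d d' : Order.disp_t) (P : finPOrderType d) (Q : finPOrderType d').

Lemma graph_isomorphic_comparable :
  graph_isomorphic (comparability_graph P) (comparability_graph Q) ->
  exists (f : P -> Q) (g : Q -> P),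
    [/\ cancel f g, cancel g f & forall x y, (f x >=< f y)%O = (x >=< y)%O].
Proof.
case=> f [g fK gK] fE; exists f, g; split=> // x y.
have [->|xy] := eqVneq x y; first by rewrite !comparablexx.
by have := fE x y; rewrite /comparability_graph /= xy (inj_eq (can_inj fK)) xy.
Qed.

Variables (f : P -> Q) (g : Q -> P).
Hypotheses (fK : cancel f g) (gK : cancel g f).
Hypothesis fE : forall x y, (f x >=< f y)%O = (x >=< y)%O.

Lemma imset_chain (C : {set P}) : is_chain C -> is_chain (f @: C).
Proof.
move=> /is_chainP hC; apply/is_chainP => _ _ /imsetP[x xC ->] /imsetP[y yC ->].
by rewrite fE hC.
Qed.

Lemma max_chain_card_le : max_chain_card P <= max_chain_card Q.
Proof.
apply/bigmax_leqP => C hC; rewrite -(card_imset _ (can_inj fK)).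
apply: (@leq_bigmax_cond _ _ (fun C : {set Q} => #|C|)); exact: imset_chain.
Qed.

End ComparabilityInvariance.

Section GraphInvariants.
Variables (d d' : Order.disp_t) (P : finPOrderType d) (Q : finPOrderType d').
Variables (f : P -> Q) (g : Q -> P).
Hypotheses (fK : cancel f g) (gK : cancel g f).
Hypothesis fE : forall x y, (f x >=< f y)%O = (x >=< y)%O.

Let gE x y : (g x >=< g y)%O = (x >=< y)%O.
Proof. by rewrite -fE !gK. Qed.

Lemma max_chain_card_iso : max_chain_card P = max_chain_card Q.
Proof. by apply/eqP; rewrite eqn_leq (max_chain_card_le fK fE) (max_chain_card_le gK gE). Qed.

Lemma rank_iso : rank P = rank Q.
Proof. by rewrite /rank -!/(max_chain_card _) max_chain_card_iso. Qed.

(** Chains are the cliques of the comparability graph, so maximal chains correspond and keep their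
    size. *)
Lemma graded_iso : graded P -> graded Q.
Proof.
move=> gradedP; have maxg (C : {set Q}) : maxset is_chain C -> maxset is_chain (g @: C).
  case/maxsetP=> hC maxC; apply/maxsetP; split; first exact: imset_chain gE _ hC.
  move=> B hB CB; have <- : f @: B = C.
    apply: maxC; first exact: imset_chain fE _ hB.
    apply/subsetP => x xC; apply/imsetP; exists (g x); last by rewrite gK.
    exact: (subsetP CB) (imset_f g xC).
  by rewrite -imset_comp -[LHS]imset_id; apply: eq_imset => x /=; rewrite fK.
move=> C D /maxg maxC /maxg maxD; have := gradedP _ _ maxC maxD.
by rewrite /chain_length !(card_imset _ (can_inj gK)).
Qed.

End GraphInvariants.

(** * Transport along bijections, and orbits *)

Section Transport.
Variables (T T' : finType) (r : rel T) (r' : rel T') (f : T -> T') (g : T' -> T).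
Hypotheses (fK : cancel f g) (gK : cancel g f).
Hypothesis rE : forall x y, r' (f x) (f y) = r x y.

Lemma relabel_conjugate (q : nat) :
  conjugate (labeling r q) (promotion r q) (labeling r' q) (promotion r' q).
Proof.
pose h (u : {ffun T -> nat}) : {ffun T' -> nat} := [ffun y => u (g y)].
pose h' (u : {ffun T' -> nat}) : {ffun T -> nat} := [ffun x => u (f x)].
have hK u : h' (h u) = u by apply/ffunP => x; rewrite !ffunE fK.
have h'K u : h (h' u) = u by apply/ffunP => x; rewrite !ffunE gK.
have lab_h u : labeling r q u -> labeling r' q (h u).
  case/labelingP=> lt_q inc; apply/labelingP; split=> [y|x y]; rewrite !ffunE //.
  by rewrite -{1}[x]gK -{1}[y]gK rE => /inc.
have lab_h' u : labeling r' q u -> labeling r q (h' u).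
  case/labelingP=> lt_q inc; apply/labelingP; split=> [y|x y]; rewrite !ffunE //.
  by rewrite -rE => /inc.
split=> [u|]; first exact: promotion_labeling.
exists h, h'; split=> u lab; last by split; [exact: lab_h' | exact: h'K].
split=> //; first exact: lab_h.
have floorE y : floor_label r' (h u) y = floor_label r u (g y).
  rewrite /floor_label (reindex f) /=; last by apply: onW_bij; exists g.
  apply: eq_big => [x|x _]; last by rewrite ffunE fK.
  by rewrite -{1}[y]gK rE.
apply: promotion_unique => [|y]; first exact: lab_h.
rewrite [LHS]ffunE promotion_rec // floorE [h u y]ffunE.
congr (if _ && _ then _ else _); apply/forallP/forallP => H x.
  by rewrite ffunE; have := H (g x); rewrite -rE !gK.
by have := H (f x); rewrite ffunE fK -{1}[y]gK rE.
Qed.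

End Transport.

Section Orbits.
Variables (S S' : finType) (s : {perm S}) (s' : {perm S'}) (h : S -> S') (k : S' -> S).
Hypotheses (hK : cancel h k) (kK : cancel k h) (hs : forall x, h (s x) = s' (h x)).

Lemma imset_porbit x : h @: porbit s x = porbit s' (h x).
Proof.
have hX i y : h ((s ^+ i)%g y) = (s' ^+ i)%g (h y).
  by elim: i y => [|i IHi] y; rewrite ?perm1 // !expgS !permM IHi hs.
apply/setP => y; apply/imsetP/porbitP => [[z /porbitP[i ->] ->]|[i ->]].
  by exists i.
by exists ((s ^+ i)%g x); rewrite ?mem_porbit // hX.
Qed.

Lemma imset_porbits O : O \in porbits s -> h @: O \in porbits s'.
Proof. by case/imsetP=> x _ ->; rewrite imset_porbit; apply: imset_f. Qed.

End Orbits.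

Lemma porbits_bijection (S S' : finType) (s : {perm S}) (s' : {perm S'})
    (h : S -> S') (k : S' -> S) :
  cancel h k -> cancel k h -> (forall x, h (s x) = s' (h x)) ->
  exists2 F : {O | O \in porbits s} -> {O | O \in porbits s'},
    bijective F & forall O, #|sval (F O)| = #|sval O|.
Proof.
move=> hK kK hs; have ks y : k (s' y) = s (k y) by rewrite -{1}[y]kK -hs hK.
pose F (O : {O | O \in porbits s}) : {O | O \in porbits s'} :=
  exist _ (h @: sval O) (imset_porbits hs (svalP O)).
pose G (O : {O | O \in porbits s'}) : {O | O \in porbits s} :=
  exist _ (k @: sval O) (imset_porbits ks (svalP O)).
exists F; last by move=> O; rewrite /= card_imset //; apply: can_inj hK.
exists G => O; apply: val_inj; rewrite /= -imset_comp -[RHS]imset_id;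
  by apply: eq_imset => x /=; rewrite ?hK ?kK.
Qed.

Section Main.
Variables (d d' : Order.disp_t) (P : finPOrderType d) (Q : finPOrderType d').
Hypotheses (gradedP : graded P) (gradedQ : graded Q).
Hypothesis iso : graph_isomorphic (comparability_graph P) (comparability_graph Q).

(** The order of [Q] is pulled back along [f], so that two orders orient one graph on [P];
    [max_chain_card_iso] gives both rowmotions the same label bound. *)
Lemma rowmotion_orbits_bijection (c : nat) :
  exists2 F : {O | O \in rowmotion_orbits (P *p 'I_c)} ->
              {O | O \in rowmotion_orbits (Q *p 'I_c)},
    bijective F & forall O, #|sval (F O)| = #|sval O|.
Proof.
have [f [g [fK gK fE]]] := graph_isomorphic_comparable iso.
pose r2 : rel P := fun x y => (f x < f y)%O.
have adj : adjacent (<%O : rel P) =2 adjacent r2.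
  have adjE (d1 : Order.disp_t) (R : finPOrderType d1) (x y : R) :
      ((x < y) || (y < x))%O = (x != y) && (x >=< y)%O.
    by rewrite !lt_neqAle [y == x]eq_sym -andb_orr.
  by move=> x y; rewrite /adjacent /r2 !adjE fE (inj_eq (can_inj fK)).
have st2 : strict_order r2.
  by split=> [x|y x z]; rewrite /r2 ?ltxx //; apply: lt_trans.
have conjP := rowmotion_promotion_conjugate c (graded_is_rank gradedP).
have conjQ := rowmotion_promotion_conjugate c (graded_is_rank gradedQ).
rewrite -(max_chain_card_iso fK gK fE) in conjQ.
have conjPQ := orientation_conjugate (lt_strict P) st2 adj (max_chain_card P + c).
have conjT := @relabel_conjugate _ _ r2 (<%O : rel Q) f g fK gK (fun _ _ => erefl)
  (max_chain_card P + c).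
have [_ [h [k [hP kP]]]] := conjugate_trans conjP (conjugate_trans conjPQ
  (conjugate_trans conjT (conjugate_sym conjQ))).
apply: (@porbits_bijection _ _ _ _ h k) => [x|y|x].
- by have [] := hP x isT.
- by have [] := kP y isT.
- by rewrite !permE; have [] := hP x isT.
Qed.

Lemma nrp_rowmotion_iso : nrp_rowmotion P <-> nrp_rowmotion Q.
Proof.
have [f [g [fK gK fE]]] := graph_isomorphic_comparable iso.
have rankE := rank_iso fK gK fE.
split=> -[_ nrp]; split=> // c c_gt0 O orbO;
  have [F [G FK GK] FE] := rowmotion_orbits_bijection c.
  have := nrp c c_gt0 _ (svalP (G (exist _ O orbO))).
  by rewrite -FE GK rankE.
have := nrp c c_gt0 _ (svalP (F (exist _ O orbO))).
by rewrite FE -rankE.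
Qed.

End Main.

Lemma osum_swap_isomorphic (d d' : Order.disp_t) (P : finPOrderType d)
    (Q : finPOrderType d') :
  graph_isomorphic (comparability_graph (osum P Q)) (comparability_graph (osum Q P)).
Proof.
pose swap (A B : Type) (u : osum A B) : osum B A :=
  match u with inl x => inr x | inr y => inl y end.
exists (@swap P Q); first by exists (@swap Q P); case.
by case=> x [] y; rewrite /= /Order.comparable.
Qed.

Theorem corollary5p2 :
  (forall (d d' : Order.disp_t) (P : finPOrderType d) (Q : finPOrderType d'),
      graded P -> graded Q ->
      graph_isomorphic (comparability_graph P) (comparability_graph Q) ->
      (forall c : nat, (0 < c)%N ->
         exists2 F : {O | O \in rowmotion_orbits (P *p 'I_c)} ->
                     {O | O \in rowmotion_orbits (Q *p 'I_c)},
           bijective F & forall O, #|sval (F O)| = #|sval O|)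
      /\ (nrp_rowmotion P <-> nrp_rowmotion Q))
  /\
  (forall (d : Order.disp_t) (P : finPOrderType d),
      graded P ->
      nrp_rowmotion (osum P 'I_1) -> nrp_rowmotion (osum 'I_1 P)).
Proof.
split=> [d d' P Q gradedP gradedQ iso|d P _ nrp].
  split=> [c _|]; first exact: rowmotion_orbits_bijection.
  exact: nrp_rowmotion_iso.
have iso := osum_swap_isomorphic P 'I_1.
have [f [g [fK gK fE]]] := graph_isomorphic_comparable iso.
(* Gradedness of [osum P 'I_1] is part of its NRP property and passes to [osum 'I_1 P] through the
   graph. *)
have gradedP1 := nrp.1; have graded1P := graded_iso fK gK fE gradedP1.
exact/(nrp_rowmotion_iso gradedP1 graded1P iso).
Qed.
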